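(* Let $1\le p<2$, let $\gamma>0$ be an arbitrarily small constant, and let $A\in\mathbb{R}^{n\times d}$ be an Auerbach basis of a $d$-dimensional subspace of $(\mathbb{R}^n,\|\cdot\|_p)$. Let $u_1,\dots,u_n$ be i.i.d. standard exponential random variables and let $D\in\mathbb{R}^{n\times n}$ be diagonal with $D_{ii}=1/u_i^{1/p}$. Let $S\in\mathbb{R}^{m\times n}$, $m=O(d^{1+\gamma})$, be drawn (independently of $D$) from the sparse oblivious subspace embedding of Nelson–Nguyen with $s=O(1)$ nonzero entries per column, i.e. $S=\frac{1}{\sqrt s}(S_1;\dots;S_s)$ (vertical stacking) where each $S_j\in\mathbb{R}^{(m/s)\times n}$ has in each column exactly one nonzero entry, equal to a uniformly random sign and placed in a uniformly random row, with parameters chosen so that $S$ is an oblivious subspace embedding. Set $\Pi=SD\in\mathbb{R}^{O(d^{1+\gamma})\times n}$. Then with probability at least $2/3$, simultaneously for all $x\in\mathbb{R}^d$, $$\Omega\Big(\max\Big\{\frac{1}{(d\log d\log n)^{\frac1p-\frac12}},\ \frac{1}{(d\log d)^{1/p}}\Big\}\Big)\cdot\|Ax\|_p\le\|\Pi Ax\|_2\le O\big((d\log d)^{1/p}\big)\cdot\|Ax\|_p.$$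
   Context: A standard exponential random variable has density $e^{-x}$ on $[0,\infty)$. An oblivious subspace embedding (for $d$) is a distribution over $m\times n$ matrices $S$ such that for every fixed $d$-dimensional subspace $V\subseteq\mathbb{R}^n$, with probability $0.99$ over $S$, $\frac12\|v\|_2\le\|Sv\|_2\le\frac32\|v\|_2$ for all $v\in V$. An Auerbach basis of a $d$-dimensional subspace $V$ of $(\mathbb{R}^n,\|\cdot\|_p)$ is a matrix $A$ whose columns $A_1,\dots,A_d$ form a basis of $V$ with $\|A_i\|_p=1$ for all $i$ and $|x_i|\le\|Ax\|_p$ for all $x\in\mathbb{R}^d$. The constants in $\Omega(\cdot),O(\cdot)$ are absolute.
   Formalization: The implied constants may depend on p (but on nothing else), since constants uniform over all p in [1,2) make the claim false as p tends to 2; and d ≥ 2 is required, since at d = 1, log d = 0 makes the bounds 1/0 and 0. *)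

(* Defs.v *)
From mathcomp Require Import all_boot all_order all_algebra.
From mathcomp Require Import all_classical all_reals all_analysis.

Set Implicit Arguments.
Unset Strict Implicit.
Unset Printing Implicit Defensive.

Import Order.TTheory GRing.Theory Num.Theory.
Import numFieldNormedType.Exports.

Local Open Scope classical_set_scope.
Local Open Scope ring_scope.

Definition lpnorm (R : realType) (n : nat) (p : R) (x : 'cV[R]_n) : R :=
  (\sum_(i < n) `|x i 0| `^ p) `^ p^-1.

Definition auerbach_basis (R : realType) (n d : nat) (p : R)
    (V : {vspace 'cV[R]_n}) (A : 'M[R]_(n, d)) : Prop :=
  [/\ basis_of V [seq col j A | j <- enum 'I_d],
      (forall j : 'I_d, lpnorm p (col j A) = 1)
    & (forall (x : 'cV[R]_d) (i : 'I_d), `|x i 0| <= lpnorm p (A *m x))].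

(* A property of the law of the random matrix [S] under [P]; [d] is the
   dimension of the embedded subspaces. *)
Definition oblivious_subspace_embedding (R : realType)
    (disp : measure_display) (T : measurableType disp) (P : probability T R)
    (d m n : nat) (S : T -> 'M[R]_(m, n)) : Prop :=
  forall V : {vspace 'cV[R]_n}, \dim V = d ->
    let E := [set t | forall v, v \in V ->
      2^-1 * lpnorm 2 v <= lpnorm 2 (S t *m v) <= 3 / 2 * lpnorm 2 v] in
    ((99 / 100 : R)%:E <= P E)%E.

(* The random choices behind a sparse embedding with [s] blocks of [r] rows:
   for block [j] and column [i], a sign bit and the row of the nonzero entry. *)
Definition sparse_seed (s r n : nat) : Type :=
  {ffun 'I_s * 'I_n -> bool * 'I_r}.

Definition sparse_block (R : realType) (s r n : nat) (w : sparse_seed s r n)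
    (j : 'I_s) : 'M[R]_(r, n) :=
  \matrix_(a < r, i < n)
    (if a == (w (j, i)).2 then (-1) ^+ (w (j, i)).1 else 0).

(* The number of rows, m = s * r, appears as [\sum_(j < s) r], the type of a
   vertical stack of [s] blocks in the library. *)
Definition sparse_embedding (R : realType) (s r n : nat)
    (w : sparse_seed s r n) : 'M[R]_(\sum_(j < s) r, n) :=
  (Num.sqrt s%:R)^-1 *: \mxcol_(j < s) sparse_block R w j.

(* As the type of seeds is a finite product, a uniform seed makes all signs and
   all row positions uniform and mutually independent. *)
Definition uniform_seed (R : realType) (disp : measure_display)
    (T : measurableType disp) (P : probability T R) (s r n : nat)
    (w : T -> sparse_seed s r n) : Prop :=
  forall f : sparse_seed s r n,
    measurable (w @^-1` [set f]) /\
    P (w @^-1` [set f]) = ((#|{: sparse_seed s r n}|%:R)^-1)%:E.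

Definition iid_std_exponential (R : realType) (disp : measure_display)
    (T : measurableType disp) (P : probability T R) (n : nat)
    (u : 'I_n -> {RV P >-> R}) : Prop :=
  (forall (i : 'I_n) (B : set R), measurable B ->
     P (u i @^-1` B) = exponential_prob 1 B) /\
  (* [B i] may be the full set, so this covers all subfamilies *)
  (forall B : 'I_n -> set R, (forall i, measurable (B i)) ->
     P (\bigcap_(i in [set: 'I_n]) (u i @^-1` B i)) =
     (\prod_(i < n) P (u i @^-1` B i))%E).

(* Cylinders form a pi-system generating the sigma-algebra of [u], so the
   product rule on them is independence of [w] and the vector [u]. *)
Definition seed_independent (R : realType) (disp : measure_display)
    (T : measurableType disp) (P : probability T R) (s r n : nat)
    (w : T -> sparse_seed s r n) (u : 'I_n -> {RV P >-> R}) : Prop :=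
  forall (f : sparse_seed s r n) (B : 'I_n -> set R),
    (forall i, measurable (B i)) ->
    P (w @^-1` [set f] `&` \bigcap_(i in [set: 'I_n]) (u i @^-1` B i)) =
    (P (w @^-1` [set f]) * P (\bigcap_(i in [set: 'I_n]) (u i @^-1` B i)))%E.

Definition exp_scaling (R : realType) (n : nat) (p : R) (u : 'I_n -> R) :
    'M[R]_n :=
  diag_mx (\row_(i < n) (u i `^ p^-1)^-1).

(* Main.v *)
Require Import Defs.
From mathcomp Require Import all_boot all_order all_algebra all_fingroup.
From mathcomp Require Import all_classical all_reals all_analysis.
From mathcomp Require Import measurable_realfun ring lra.

Set Implicit Arguments.
Unset Strict Implicit.
Unset Printing Implicit Defensive.

Import Order.TTheory GRing.Theory Num.Theory.
Import numFieldNormedType.Exports.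

Local Open Scope ring_scope.

(**
As the law of [S] does not depend on [u], the subspace embedding property
applies to [D V] for almost every [u], so everything reduces to comparing
[||D y||_2] with [||y||_p] for [y] in [V].

Put [psi t = min (t^(p/2)) (t^(1/3))].  Maximising [|det U|] under the
constraint [sum_i psi (|f_i|^2) <= d L], where the [f_i] are the rows of
[A U], yields a Lewis change of density: for [q_i = |f_i|^2] and
[lam_i = psi q_i], the quadratic form [sum_i psi' q_i (f_i f_i^T)] is
comparable to [L] times the identity.  A nearly optimal [U] is enough, so no
compactness is used.  It follows that [|y_i|^p <= lam_i ||y||_p^p], and as
[sum_i lam_i <= d L] the weak-type bound for [sum_i (lam_i / u_i)^(2/p)] gives
the upper estimate.

For the lower estimate, the form [||D y||_2^2] dominates a sum of the
[f_i f_i^T], with suitable coefficients, over the random set of those [i] with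
[u_i <= lam_i].  A matrix Chernoff bound, obtained by replacing the random
coefficients one at a time in [tr ((delta + N)^-m)] with [m] of order [log d]
and estimating each step by the Sherman-Morrison formula, shows that for [L] of
order [log d] this sum dominates the form above.  Hoelder's inequality, applied
separately to the indices with [q_i <= 1] and to the at most [d L] others,
turns this into a bound for [||y||_p].  The outcome is the factor
[(d log d)^(1/p - 1/2)], without [log n].
*)

(** * Traces of powers of inverses under rank-one perturbations *)

(** Two obstacles shape the argument. The variables [u_i^(-2/p)] have infinite mean, so the upper
    estimate needs a truncation before any first moment is taken. And a row with large [q_i] is
    selected almost surely but is too large for a Chernoff bound. Its coefficient is therefore cut
    into about [lam_i] equal pieces, each failing with constant probability: a single failure
    probability [exp (- lam_i)] is no worse than that of all pieces failing together.

    [L] is an oversampling factor: it lifts the form to size [L] while a single piece has size at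
    most one, and [L] of order [log d] is what concentration in dimension [d] requires.

    Powers of the inverse take the place of matrix exponentials, so that only rational functions of
    matrices occur. The spectral theorem is avoided: the moments [w^T C^j w] and their log-convexity
    replace it. The exponent [m] has to exceed [log_2 d] for the trace to see the least eigenvalue
    up to a constant factor, and [delta >= 2 m] keeps each small step in the regime where the
    first-order change of the trace is accurate up to a constant. *)

Definition dot (R : pzRingType) (d : nat) (x y : 'cV[R]_d) : R := (x^T *m y) 0 0.

Section Dot.
Variables (R : realFieldType) (d : nat).
Implicit Types (x y z : 'cV[R]_d) (B C : 'M[R]_d) (a t : R).

Lemma dotE x y : dot x y = \sum_k x k 0 * y k 0.
Proof. by rewrite /dot mxE; apply: eq_bigr => k _; rewrite mxE. Qed.

Lemma dotC x y : dot x y = dot y x.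
Proof. by rewrite !dotE; apply: eq_bigr => k _; rewrite mulrC. Qed.

Lemma dotDl x y z : dot (x + y) z = dot x z + dot y z.
Proof. by rewrite /dot linearD /= mulmxDl mxE. Qed.

Lemma dotDr x y z : dot z (x + y) = dot z x + dot z y.
Proof. by rewrite !(dotC z) dotDl. Qed.

Lemma dotZl a x y : dot (a *: x) y = a * dot x y.
Proof. by rewrite /dot linearZ /= -scalemxAl mxE. Qed.

Lemma dotZr a x y : dot y (a *: x) = a * dot y x.
Proof. by rewrite !(dotC y) dotZl. Qed.

Lemma dot0l x : dot 0 x = 0.
Proof. by rewrite -(scale0r 0) dotZl mul0r. Qed.

Lemma dot_ge0 x : 0 <= dot x x.
Proof. by rewrite dotE; apply: sumr_ge0 => k _; rewrite -expr2 sqr_ge0. Qed.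

Lemma dot_eq0 x : dot x x = 0 -> x = 0.
Proof.
rewrite dotE => /eqP; rewrite psumr_eq0 => [|k _]; last by rewrite -expr2 sqr_ge0.
move=> /allP h; apply/colP => k; rewrite mxE; apply/eqP.
by have := h k (mem_index_enum _); rewrite -expr2 sqrf_eq0.
Qed.

Lemma dot_gt0 x : x != 0 -> 0 < dot x x.
Proof.
by move=> x0; rewrite lt_def dot_ge0 andbT; apply: contra_neq x0 => /dot_eq0.
Qed.

Lemma dot_mulmx m (M : 'M[R]_(d, m)) x (y : 'cV[R]_m) :
  dot x (M *m y) = dot (M^T *m x) y.
Proof. by rewrite /dot trmx_mul trmxK mulmxA. Qed.

Lemma dot_mulmx_sym B x y : B^T = B -> dot x (B *m y) = dot (B *m x) y.
Proof. by move=> sB; rewrite dot_mulmx sB. Qed.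

Lemma mulmx_outer x y z : x *m y^T *m z = dot y z *: x.
Proof.
by rewrite -mulmxA [y^T *m z]mx11_scalar mul_mx_scalar.
Qed.

Lemma mxtrace_outer x y : \tr (x *m y^T) = dot y x.
Proof. by rewrite mxtrace_mulC /mxtrace big_ord1. Qed.

Lemma discriminant_le (a b c : R) : 0 <= a ->
  (forall t, 0 <= a * t ^+ 2 + 2 * b * t + c) -> b ^+ 2 <= a * c.
Proof.
rewrite le_eqVlt => /predU1P[<-|a0] h.
  rewrite mul0r; have [->|b0] := eqVneq b 0; first by rewrite expr0n.
  have := h (- ((c + 1) / (2 * b))); rewrite mul0r add0r mulrN.
  by rewrite mulrC divfK ?mulf_neq0 ?pnatr_eq0 //; lra.
have := h (- (b / a)); set t := b / a.
have -> : b = t * a by rewrite /t divfK //; lra.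
nra.
Qed.

Definition possemi B := B^T = B /\ forall x, 0 <= dot x (B *m x).

Lemma cauchy_schwarz_mx B x y : possemi B ->
  dot x (B *m y) ^+ 2 <= dot x (B *m x) * dot y (B *m y).
Proof.
move=> [sB pB]; apply: discriminant_le => // t.
have := pB (t *: x + y).
rewrite mulmxDr -scalemxAr !(dotDl, dotDr, dotZl, dotZr).
rewrite (dot_mulmx_sym y x sB) (dotC (B *m y)); lra.
Qed.

Lemma possemi1 : possemi 1%:M.
Proof. by split=> [|x]; rewrite ?trmx1 ?mul1mx ?dot_ge0. Qed.

Lemma cauchy_schwarz x y : dot x y ^+ 2 <= dot x x * dot y y.
Proof. by have := cauchy_schwarz_mx x y possemi1; rewrite !mul1mx. Qed.

Lemma trmx_exp B j : (B ^+ j)^T = B^T ^+ j.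
Proof.
elim: j => [|j IH]; first by rewrite !expr0 trmx1.
by rewrite exprSr exprS -IH -!mulmxE trmx_mul.
Qed.

Lemma mulmx_exprS p B j (M : 'M[R]_(d, p)) : B *m (B ^+ j *m M) = B ^+ j.+1 *m M.
Proof. by rewrite mulmxA exprS. Qed.

Lemma mulmx_exprSr p B j (M : 'M[R]_(d, p)) : B ^+ j *m (B *m M) = B ^+ j.+1 *m M.
Proof. by rewrite mulmxA exprSr. Qed.

(** [B ^+ j] factors as [B ^+ j./2], then [B] or the identity according to parity, then [B ^+ j./2].
    Its form is thus the form of [B] or of the identity at a transformed vector, without any
    diagonalisation. *)
Lemma possemi_exp B j : possemi B -> possemi (B ^+ j).
Proof.
move=> [sB pB]; split=> [|x]; first by rewrite trmx_exp sB.
have sBj i : (B ^+ i)^T = B ^+ i by rewrite trmx_exp sB.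
rewrite -[j]odd_double_half -addnn exprD exprD -!mulmxE.
rewrite [_ *m (_ *m _)]mulmxA -mulmxA.
case: (odd j); rewrite ?expr1 ?expr0 ?mul1mx.
  have -> : B *m B ^+ j./2 = B ^+ j./2 *m B by rewrite mulmxE -exprS exprSr.
  by rewrite -mulmxA dot_mulmx_sym.
by rewrite dot_mulmx_sym // dot_ge0.
Qed.

End Dot.

(** * Coercive matrices and the moments of their inverses *)

Section RankOne.
Variables (R : realFieldType) (d : nat).
Implicit Types (x y z w : 'cV[R]_d) (B C : 'M[R]_d) (a t delta : R).

Definition coercive delta B :=
  B^T = B /\ forall x, delta * dot x x <= dot x (B *m x).

Lemma coercive_unit delta B : 0 < delta -> coercive delta B -> B \in unitmx.
Proof.
move=> d0 [sB cB]; rewrite -row_free_unit; apply: inj_row_free => v vB.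
have /dot_eq0 v0 : dot v^T v^T = 0.
  apply/eqP; rewrite eq_le dot_ge0 andbT -(pmulr_rle0 _ d0).
  have Bv : B *m v^T = 0 by apply: trmx_inj; rewrite trmx_mul trmxK sB vB trmx0.
  by have := cB v^T; rewrite Bv {2}/dot mulmx0 mxE.
by apply: trmx_inj; rewrite v0 trmx0.
Qed.

Lemma coercive_outer delta B w t : 0 <= t -> coercive delta B ->
  coercive delta (B + t *: (w *m w^T)).
Proof.
move=> t0 [sB cB]; split=> [|x].
  by rewrite linearD linearZ /= trmx_mul trmxK sB.
rewrite mulmxDl -scalemxAl mulmx_outer dotDr !dotZr (dotC x w).
by apply: le_trans (cB x) _; rewrite lerDl mulr_ge0 // -expr2 sqr_ge0.
Qed.

Lemma invmx_possemi delta B : 0 < delta -> coercive delta B ->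
  possemi (invmx B).
Proof.
move=> d0 cB; have uB := coercive_unit d0 cB; case: cB => sB cB.
have sC : (invmx B)^T = invmx B by rewrite trmx_inv sB.
split=> // x; have := cB (invmx B *m x).
rewrite mulKVmx // (dotC _ x) => h.
by apply: le_trans h; rewrite mulr_ge0 ?dot_ge0 // ltW.
Qed.

Lemma invmx_le delta B x : 0 < delta -> coercive delta B ->
  dot x (invmx B *m x) <= dot x x / delta.
Proof.
move=> d0 cB; have uB := coercive_unit d0 cB.
have [sC _] := invmx_possemi d0 cB; case: cB => sB cB.
have := cB (invmx B *m x); rewrite mulKVmx // (dotC _ x).
have := cauchy_schwarz x (invmx B *m x).
have := dot_ge0 (invmx B *m x); have := dot_ge0 x.
set X := dot x x; set Z := dot (_ *m _) (_ *m _); set c := dot x _.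
move=> X0 Z0 cs le_c; rewrite ler_pdivlMr //.
have c0 : 0 <= c by apply: le_trans le_c; rewrite mulr_ge0 // ltW.
have [->|cn0] := eqVneq c 0; first by rewrite mul0r.
have cp : 0 < c by rewrite lt_def cn0.
by rewrite -(ler_pM2l cp); nra.
Qed.

(** The moments of the spectral measure of [C] at [w]. What a spectral decomposition would give is
    drawn from their nonnegativity and log-convexity in [j]. *)
Definition moment C w j := dot w (C ^+ j *m w).

Lemma moment_ge0 C w j : possemi C -> 0 <= moment C w j.
Proof. by move=> pC; apply: (possemi_exp j pC).2. Qed.

Lemma moment_sqr C w j : possemi C ->
  moment C w j.+1 ^+ 2 <= moment C w j * moment C w j.+2.
Proof.
move=> pC; have pCj := possemi_exp j pC; have [sC _] := pC.
have := cauchy_schwarz_mx w (C *m w) pCj.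
by rewrite mulmx_exprSr -(dot_mulmx_sym w _ sC) mulmx_exprS.
Qed.

(** The ratios of consecutive terms of a log-convex sequence increase. [step] is the
    cross-multiplied form of this, which remains meaningful when terms vanish. *)
Lemma logconvex_shift (h : nat -> R) i j : (forall l, 0 <= h l) ->
  (forall l, h l.+1 ^+ 2 <= h l * h l.+2) -> h i * h j <= h 0%N * h (i + j)%N.
Proof.
move=> h0 hh.
have step k l : (k <= l)%N -> h k.+1 * h l <= h k * h l.+1.
  elim: l => [|l IH]; first by rewrite leqn0 => /eqP ->; rewrite mulrC.
  rewrite leq_eqVlt => /predU1P[->|]; first by rewrite mulrC.
  rewrite ltnS => /IH; have := hh l; have := h0 k.+1; have := h0 k.
  have := h0 l; have := h0 l.+1; have := h0 l.+2.
  move: (h k) (h k.+1) (h l) (h l.+1) (h l.+2).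
  move=> x y a b c c0 b0 a0 x0 y0 bac ya_xb.
  have [a_eq0|an0] := eqVneq a 0.
    have -> : b = 0 by rewrite a_eq0 mul0r in bac; nra.
    by rewrite mulr0 mulr_ge0.
  have ap : 0 < a by rewrite lt_def an0.
  rewrite -(ler_pM2l ap); nra.
wlog ij : i j / (i <= j)%N.
  move=> wl; have [|/ltnW] := leqP i j; first exact: wl.
  by rewrite mulrC addnC; apply: wl.
elim: i j ij => [|i IH] j ij; first by [].
apply: le_trans (step i j (ltnW ij)) _.
by rewrite addSnnS; apply: IH; rewrite ltnW // ltnW.
Qed.

Lemma moment_shift C w i j : possemi C ->
  moment C w i.+1 * moment C w j.+1 <= moment C w 1 * moment C w (i + j).+1.
Proof.
move=> pC; apply: (@logconvex_shift (fun l => moment C w l.+1)) => l.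
  exact: moment_ge0.
exact: moment_sqr.
Qed.

(** Jensen's inequality for the spectral measure of total mass [dot w w], by induction from
    log-convexity. *)
Lemma moment1_exp C w j : possemi C ->
  moment C w 1 ^+ j.+1 <= dot w w ^+ j * moment C w j.+1.
Proof.
move=> pC; have h0 l := moment_ge0 w l pC.
elim: j => [|j IH]; first by rewrite expr0 mul1r.
have := @logconvex_shift (moment C w) 1 j.+1 h0 (fun l => moment_sqr w l pC).
have -> : moment C w 0 = dot w w by rewrite /moment expr0 mul1mx.
rewrite add1n exprS [dot w w ^+ _]exprS => h.
apply: (le_trans (ler_wpM2l (h0 1%N) IH)).
rewrite mulrCA -mulrA [leRHS]mulrCA ler_wpM2l //.
by rewrite exprn_ge0 ?dot_ge0.
Qed.

(** Positivity at the vectors [x_i e_j - x_j e_i], summed over all pairs, bounds the form by the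
    trace without eigenvalues. *)
Lemma possemi_le_trace (M : 'M[R]_d) x : possemi M ->
  dot x (M *m x) <= dot x x * \tr M.
Proof.
move=> [sM pM].
have entry i j : dot (delta_mx i 0) (M *m delta_mx j 0) = M i j.
  by rewrite /dot trmx_delta mulmxA -rowE -colE !mxE.
have pair i j : 2 * (x i 0 * M i j * x j 0) <=
    x i 0 ^+ 2 * M j j + x j 0 ^+ 2 * M i i.
  have := pM (x i 0 *: delta_mx j 0 - x j 0 *: delta_mx i 0).
  rewrite mulmxBr -!scalemxAr -scaleN1r -(scaleN1r (_ *: (M *m _))).
  rewrite !(dotDl, dotDr, dotZl, dotZr) !entry.
  have -> : M j i = M i j by rewrite -[in LHS]sM mxE.
  lra.
have -> : dot x (M *m x) = \sum_i \sum_j x i 0 * M i j * x j 0.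
  rewrite dotE; apply: eq_bigr => i _; rewrite mxE mulr_sumr.
  by apply: eq_bigr => j _; rewrite mulrA.
have S : dot x x * \tr M = \sum_i \sum_j x i 0 ^+ 2 * M j j.
  rewrite dotE mulr_suml; apply: eq_bigr => i _.
  by rewrite /mxtrace mulr_sumr; apply: eq_bigr => j _; rewrite expr2.
have S' : dot x x * \tr M = \sum_i \sum_j x j 0 ^+ 2 * M i i.
  by rewrite S exchange_big.
rewrite -(ler_pM2l (_ : 0 < 2 :> R)) //.
rewrite [leRHS]mulrDl !mul1r {1}S S' -big_split /=.
rewrite mulr_sumr; apply: ler_sum => i _; rewrite -big_split /= mulr_sumr.
by apply: ler_sum => j _; apply: pair.
Qed.

(** The diagonal entries of the power are moments at the basis vectors. Two powers are removed at a
    time, because [|C w|^2 <= |w|^2 / delta^2]; a leftover single power is covered by [invmx_le]. *)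
Lemma trace_invmx_exp_le delta B m : 0 < delta -> coercive delta B ->
  \tr (invmx B ^+ m) <= d%:R * delta^-1 ^+ m.
Proof.
move=> d0 cB; have uB := coercive_unit d0 cB; have pC := invmx_possemi d0 cB.
have h w j : moment (invmx B) w j <= dot w w * delta^-1 ^+ j.
  have Cw2 x : dot (invmx B *m x) (invmx B *m x) <= dot x x * delta^-1 ^+ 2.
    have := cB.2 (invmx B *m x); rewrite mulKVmx // (dotC _ x) => h.
    have := le_trans h (invmx_le x d0 cB).
    by rewrite mulrC -ler_pdivlMr // expr2 mulrA.
  have [k ->] : exists k, j = (k.*2 + odd j)%N.
    by exists j./2; rewrite addnC odd_double_half.
  elim: k w => [|k IH] w.
    case: (odd j); last by rewrite /moment !expr0 mul1mx mulr1.
    by rewrite /moment !expr1 invmx_le.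
  have -> : moment (invmx B) w (k.+1.*2 + odd j) =
            moment (invmx B) (invmx B *m w) (k.*2 + odd j).
    by rewrite /moment -(dot_mulmx_sym _ _ pC.1) mulmx_exprSr mulmx_exprS.
  apply: le_trans (IH _) _; rewrite doubleS !addSn !exprS !mulrA ler_wpM2r //.
    by rewrite exprn_ge0 // invr_ge0 ltW.
  by have := Cw2 w; rewrite expr2 mulrA.
rewrite mulr_natl -[d in X in _ <= X]card_ord -sumr_const.
apply: ler_sum => i _; have := h (delta_mx i 0) m.
have e : dot (delta_mx i 0) (delta_mx i 0) = 1 :> R.
  by rewrite /dot trmx_delta mul_delta_mx mxE eqxx.
by rewrite e mul1r /moment /dot trmx_delta mulmxA -rowE -colE !mxE.
Qed.

(** The trace bounds the moment of order [m.+1], and [moment1_exp] passes from it to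
    [<x, C x> <= |x|^2 / a] for the inverse [C]. Cauchy-Schwarz in the form of [C], between [x] and
    [B x], inverts this. *)
Lemma coercive_of_trace delta B m a : 0 < delta -> coercive delta B ->
  0 < a -> \tr (invmx B ^+ m.+1) <= a^-1 ^+ m.+1 -> coercive a B.
Proof.
move=> d0 cB a0 trle; have uB := coercive_unit d0 cB.
have pC := invmx_possemi d0 cB; split=> [|x]; first by case: cB.
have [->|x0] := eqVneq x 0; first by rewrite mulmx0 !dot0l mulr0.
have xx := dot_gt0 x0.
have le1 : moment (invmx B) x 1 <= dot x x / a.
  have xa : 0 <= dot x x / a by rewrite divr_ge0 // ltW.
  rewrite -(ler_pXn2r (ltn0Sn m)) ?nnegrE ?moment_ge0 //.
  apply: le_trans (moment1_exp x m pC) _.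
  rewrite expr_div_n exprSr -mulrA -exprVn ler_wpM2l ?exprn_ge0 ?(ltW xx) //.
  apply: le_trans (possemi_le_trace x (possemi_exp _ pC)) _.
  by rewrite ler_wpM2l // ltW.
have := cauchy_schwarz_mx x (B *m x) pC.
rewrite mulKmx // (dotC (B *m x)) -[X in _ <= dot x X * _]/(invmx B *m x).
move: le1; rewrite /moment expr1 => le1 cs.
have B0 : 0 <= dot x (B *m x).
  by apply: le_trans (cB.2 x); rewrite mulr_ge0 ?ltW.
rewrite -(ler_pM2l xx) mulrCA -expr2 mulrC -ler_pdivlMr //.
by apply: le_trans cs _; rewrite mulrAC ler_wpM2r.
Qed.

End RankOne.

(** * Change of the trace of a power under one rank-one update *)

Section TraceStep.
Variables (R : realFieldType) (d : nat) (delta : R) (B : 'M[R]_d).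
Variables (w : 'cV[R]_d) (t : R).
Hypotheses (delta0 : 0 < delta) (cB : coercive delta B) (t0 : 0 <= t).

Let C := invmx B.
Let C' := invmx (B + t *: (w *m w^T)).
Let h := moment C w.
Let k := t / (1 + t * h 1).

Let pC : possemi C. Proof. exact: invmx_possemi delta0 cB. Qed.
Let cB' : coercive delta (B + t *: (w *m w^T)).
Proof. exact: coercive_outer. Qed.
Let pC' : possemi C'. Proof. exact: invmx_possemi delta0 cB'. Qed.
Let h0 j : 0 <= h j. Proof. exact: moment_ge0. Qed.
Let den0 : 0 < 1 + t * h 1.
Proof. by rewrite ltr_pwDl // mulr_ge0. Qed.
Let k0 : 0 <= k. Proof. by rewrite divr_ge0 // ltW. Qed.

Lemma sherman_morrison : C' = C - k *: ((C *m w) *m (C *m w)^T).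
Proof.
have uB := coercive_unit delta0 cB; have uB' := coercive_unit delta0 cB'.
have sC : C^T = C := pC.1.
set v := C *m w; have e1 : B *m v = w by rewrite mulKVmx.
have e2 : w^T *m C = v^T by rewrite trmx_mul sC.
have e3 : w^T *m v = (h 1)%:M by rewrite [LHS]mx11_scalar /h /moment expr1.
have e4 : (B + t *: (w *m w^T)) *m C = 1%:M + t *: (w *m v^T).
  by rewrite mulmxDl mulmxV // -scalemxAl -mulmxA e2.
have e5 : (B + t *: (w *m w^T)) *m (v *m v^T) = (1 + t * h 1) *: (w *m v^T).
  rewrite mulmxDl mulmxA e1 -scalemxAl -(mulmxA w) (mulmxA w^T) e3 mul_scalar_mx.
  by rewrite -scalemxAr scalerDl scale1r scalerA.
apply: (can_inj (mulKmx uB')); rewrite mulmxV // mulmxBr e4 -scalemxAr e5 scalerA.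
by rewrite /k divfK ?gt_eqF // addrK.
Qed.

(** Mixed moments, interpolating between powers of [C] and of [C']. By Sherman-Morrison each further
    factor [C'] in place of [C] loses a multiple of [X j 1], so that [X j i] stays between
    [1 - k h_1 j] times [h (i + j).+1] and [h (i + j).+1] itself. *)
Let X j i := dot (C ^+ i *m w) (C' ^+ j *m (C *m w)).

Let X0 i : X 0 i = h i.+1.
Proof.
have sCi : (C ^+ i)^T = C ^+ i by rewrite trmx_exp pC.1.
by rewrite /X expr0 mul1mx -(dot_mulmx_sym _ _ sCi) mulmx_exprSr.
Qed.

Let XS j i : X j.+1 i = X j i.+1 - k * h i.+1 * X j 1.
Proof.
have sCi : (C ^+ i)^T = C ^+ i by rewrite trmx_exp pC.1.
rewrite /X -mulmx_exprS (dot_mulmx_sym _ _ pC'.1).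
rewrite {1}sherman_morrison mulmxBl -scalemxAl mulmx_outer.
rewrite mulmx_exprS expr1.
have -> : dot (C *m w) (C ^+ i *m w) = h i.+1.
  by rewrite -(dot_mulmx_sym _ _ pC.1) mulmx_exprS.
by rewrite -scaleN1r dotDl !dotZl mulN1r mulrA.
Qed.

Let X1_ge0 j : 0 <= X j 1.
Proof. by rewrite /X expr1; exact: (possemi_exp j pC').2. Qed.

Let X_le j i : X j i <= h (i + j).+1.
Proof.
elim: j i => [|j IH] i; first by rewrite X0 addn0.
rewrite XS -addSnnS; apply: le_trans (IH i.+1).
by rewrite gerBl mulr_ge0 // mulr_ge0.
Qed.

Let X_ge j i : h (i + j).+1 * (1 - k * h 1 * j%:R) <= X j i.
Proof.
elim: j i => [|j IH] i; first by rewrite X0 addn0 mulr0 subr0 mulr1.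
rewrite XS; have := IH i.+1; have := X_le j 1; rewrite add1n addSnnS.
(* The loss [h i.+1 * h j.+2] is reduced to [h 1] times the leading moment. *)
have := moment_shift w i j.+1 pC; rewrite -/h -(natr1 j).
have := h0 i.+1; have := X1_ge0 j; have := k0; have := h0 (i + j.+1).+1.
move: (h 1) (h i.+1) (h j.+2) (h _.+1) (X j 1) (X j i.+1) (j%:R : R) => a b c e x y J.
move=> e0 k_ge0 x0 b0 bc xc ey.
have : k * (b * x) <= k * (a * e).
  by rewrite ler_wpM2l // (le_trans _ bc) // ler_wpM2l.
lra.
Qed.

(** Telescoping along the traces of [C ^+ (m - j) *m C' ^+ j]: each difference contains one factor
    [C - C'], which has rank one, so its trace collapses to a mixed moment. *)
Let trace_diff m : \tr (C ^+ m) - \tr (C' ^+ m) = k * \sum_(j < m) X j (m - j).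
Proof.
pose T j := \tr (C ^+ (m - j) *m C' ^+ j).
have step j : (j < m)%N -> T j - T j.+1 = k * X j (m - j).
  move=> jm; rewrite /T -linearB /= -(subnSK jm) exprSr exprS.
  rewrite -[C ^+ _ * C]/(C ^+ _ *m C) -[C' * _]/(C' *m _) -mulmxA -mulmxBr -mulmxBl.
  have -> : C - C' = k *: ((C *m w) *m (C *m w)^T).
    by rewrite sherman_morrison opprB addrCA subrr addr0.
  rewrite -scalemxAl -scalemxAr linearZ /= !mulmxA -mulmxA; congr (_ * _).
  have -> : (C *m w)^T *m C' ^+ j = (C' ^+ j *m (C *m w))^T.
    by rewrite [RHS]trmx_mul trmx_exp pC'.1.
  by rewrite mxtrace_outer dotC /X exprSr.
have : T 0%N - T m = k * \sum_(j < m) X j (m - j).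
  rewrite mulr_sumr -(big_mkord xpredT (fun j => k * X j (m - j))).
  rewrite (telescope_sumr_eq (fun j => - T j)) => // [|j /step <-].
    by rewrite opprK addrC.
  by rewrite opprK addrC.
by rewrite /T subn0 subnn !expr0 mulmx1 mul1mx.
Qed.

Lemma trace_exp_diff_le m :
  \tr (C ^+ m) - \tr (C' ^+ m) <= k * m%:R * h m.+1.
Proof.
have -> : k * m%:R * h m.+1 = k * \sum_(j < m) h m.+1.
  by rewrite sumr_const card_ord -[h _ *+ m]mulr_natl mulrA.
rewrite trace_diff ler_wpM2l //; apply: ler_sum => j _.
by have := X_le j (m - j); rewrite subnK // ltnW.
Qed.

Lemma trace_exp_diff_ge m :
  k * m%:R * h m.+1 * (1 - k * h 1 * m%:R) <= \tr (C ^+ m) - \tr (C' ^+ m).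
Proof.
have -> (c : R) : k * m%:R * h m.+1 * c = k * \sum_(j < m) (h m.+1 * c).
  by rewrite sumr_const card_ord -[_ * c *+ m]mulr_natl !mulrA.
rewrite trace_diff ler_wpM2l //; apply: ler_sum => j _.
have := X_ge j (m - j); rewrite subnK; last by rewrite ltnW.
apply: le_trans; rewrite ler_wpM2l // lerD2l lerN2 ler_wpM2l ?(mulr_ge0 k0) //.
by rewrite ler_nat ltnW.
Qed.

End TraceStep.

(** The potential of the Chernoff argument. For positive definite [B] it dominates the [m]-th power
    of the reciprocal of the least eigenvalue. *)
Definition inv_trace (R : realFieldType) (d m : nat) (B : 'M[R]_d) : R :=
  \tr (invmx B ^+ m).

(** * Random rank-one steps compared with deterministic ones *)

Section Bernoulli.
Variables (R : archiRealFieldType) (d m : nat) (delta : R).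
Hypotheses (delta2 : 2 <= delta) (deltam : 2 * m%:R <= delta).
Implicit Types (B : 'M[R]_d) (w : 'cV[R]_d) (g t pi : R).

Let delta0 : 0 < delta. Proof. by apply: lt_le_trans delta2. Qed.

(** The lower bounds on [delta] keep [g * h 1] and [g * h 1 * m] below [1/2]. Hence the
    Sherman-Morrison coefficient is at least [2 g / 3] and the correction factor at least [1/2];
    their product is the [1/3]. *)
Lemma inv_trace_small_step B w g : coercive delta B ->
  0 <= g -> g * dot w w <= 1 ->
  g / 3 * (m%:R * moment (invmx B) w m.+1) <=
  inv_trace m B - inv_trace m (B + g *: (w *m w^T)).
Proof.
move=> cB g0 gw; have := trace_exp_diff_ge w delta0 cB g0 m; apply: le_trans.
have pC := invmx_possemi delta0 cB.
have h0 := moment_ge0 w m.+1 pC; have h10 := moment_ge0 w 1 pC.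
have h1le : moment (invmx B) w 1 <= dot w w / delta.
  by rewrite /moment expr1 (invmx_le _ delta0).
have m0 : 0 <= m%:R :> R := ler0n _ _.
have gh0 : 0 <= g * moment (invmx B) w 1 by apply: mulr_ge0.
have ghd : g * moment (invmx B) w 1 * delta <= 1.
  apply: le_trans gw; rewrite -mulrA ler_wpM2l //.
  by rewrite ler_pdivlMr in h1le.
move: gh0 ghd h0 h10; clear h1le pC.
move: (moment _ _ m.+1) (moment _ _ 1) (m%:R : R) deltam m0 => H h M dM M0.
move=> gh0 ghd H0 h0.
have gh2 : g * h <= 2^-1.
  have : g * h * 2 <= 1 by apply: le_trans ghd; rewrite ler_wpM2l.
  lra.
have ghM : g * h * M <= 2^-1.
  have : g * h * (2 * M) <= 1 by apply: le_trans ghd; rewrite ler_wpM2l.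
  lra.
set k := g / (1 + g * h); have den : 0 < 1 + g * h by lra.
have k0 : 0 <= k by rewrite divr_ge0 // ltW.
have kg1 : k <= g by rewrite ler_pdivrMr //; nra.
have kg2 : 2 / 3 * g <= k.
  have : 0 <= g * (2^-1 - g * h) by rewrite mulr_ge0 // subr_ge0.
  rewrite ler_pdivlMr //; nra.
have khM : k * h * M <= 2^-1.
  by apply: le_trans ghM; rewrite !ler_wpM2r.
have MH : 0 <= M * H by apply: mulr_ge0.
have -> : k * M * H * (1 - k * h * M) = k * (1 - k * h * M) * (M * H) by ring.
by apply: ler_wpM2r => //; nra.
Qed.

(** On average the random step lowers the potential by at least [pi * g / 3] times [m * h m.+1], and
    a deterministic step of size [g * pi / 3] lowers it by at most that much. *)
Lemma inv_trace_bernoulli B w g pi : coercive delta B ->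
  0 <= g -> g * dot w w <= 1 -> 0 <= pi ->
  (1 - pi) * inv_trace m B + pi * inv_trace m (B + g *: (w *m w^T)) <=
  inv_trace m (B + (g * pi / 3) *: (w *m w^T)).
Proof.
move=> cB g0 gw pi0; have := inv_trace_small_step cB g0 gw.
have t0 : 0 <= g * pi / 3 by rewrite !mulr_ge0 ?invr_ge0.
have := trace_exp_diff_le w delta0 cB t0 m.
rewrite -!/(inv_trace m _); have pC := invmx_possemi delta0 cB.
have h0 := moment_ge0 w m.+1 pC; have h10 := moment_ge0 w 1 pC.
move: (inv_trace m B) (inv_trace m _) (inv_trace m _) h0 h10.
move: (moment _ _ m.+1) (moment _ _ 1) => H h x y z H0 h0.
set k := (g * pi / 3) / (1 + _) => le1 le2.
have MH : 0 <= m%:R * H by apply: mulr_ge0.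
have : k <= g * pi / 3.
  rewrite /k ler_pdivrMr; last by rewrite ltr_pwDl // mulr_ge0.
  by rewrite mulrDr mulr1 lerDl !mulr_ge0 ?invr_ge0.
move=> /(ler_wpM2r MH); rewrite -mulrA in le1; nra.
Qed.

(** A step of any size is a sum of steps small enough for [inv_trace_small_step], their number being
    supplied by the Archimedean property. *)
Lemma inv_trace_mono B w t t' : coercive delta B -> 0 <= t -> t <= t' ->
  inv_trace m (B + t' *: (w *m w^T)) <= inv_trace m (B + t *: (w *m w^T)).
Proof.
move=> cB t0 tt'.
have -> : t' = t + (t' - t) by rewrite addrC subrK.
rewrite scalerDl addrA.
have := coercive_outer w t0 cB; have : 0 <= t' - t by rewrite subr_ge0.
move: (B + _) (t' - t) => {cB t0 tt'}B {t'}t t0 cB.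
have small B' g : coercive delta B' -> 0 <= g -> g * dot w w <= 1 ->
    inv_trace m (B' + g *: (w *m w^T)) <= inv_trace m B'.
  move=> cB' g0 gw; have := inv_trace_small_step cB' g0 gw.
  have := moment_ge0 w m.+1 (invmx_possemi delta0 cB').
  move=> h0 h; rewrite -subr_ge0; apply: le_trans h.
  by rewrite !mulr_ge0 ?invr_ge0.
have multi N g : 0 <= g -> g * dot w w <= 1 ->
    inv_trace m (B + (N%:R * g) *: (w *m w^T)) <= inv_trace m B.
  move=> g0 gw; elim: N => [|N IH]; first by rewrite mul0r scale0r addr0.
  apply: le_trans IH; rewrite -(natr1 N) mulrDl mul1r scalerDl addrA.
  by apply: small => //; apply: coercive_outer => //; rewrite mulr_ge0.
pose N := Num.bound (t * dot w w); have N0 : 0 < N.+1%:R :> R by [].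
have := multi N.+1 (t / N.+1%:R); rewrite mulrCA divff ?gt_eqF // mulr1; apply.
  by rewrite divr_ge0.
rewrite mulrAC ler_pdivrMr // mul1r.
have /ltW/le_trans := archi_boundP (mulr_ge0 t0 (dot_ge0 w)); apply.
by rewrite ler_nat.
Qed.

(** Compare with the sum of [k] independent steps [g]: it vanishes with probability [(1 - pi) ^+ k]
    and never exceeds [k g]. As the potential decreases, the two-point variable taking the value
    [k g] otherwise has the smaller average. The induction makes one of the steps deterministic at a
    time. *)
Lemma inv_trace_binomial B w g pi k : coercive delta B ->
  0 <= g -> g * dot w w <= 1 -> 0 <= pi <= 1 ->
  (1 - pi) ^+ k * inv_trace m B +
  (1 - (1 - pi) ^+ k) * inv_trace m (B + (k%:R * g) *: (w *m w^T)) <=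
  inv_trace m (B + (k%:R * g * pi / 3) *: (w *m w^T)).
Proof.
move=> cB g0 gw /andP[pi0 pi1].
have q0 : 0 <= 1 - pi by rewrite subr_ge0.
elim: k => [|k IH].
  by rewrite expr0 subrr !mul0r addr0 mul1r scale0r addr0.
have k0 : 0 <= k%:R * g by rewrite mulr_ge0.
have kp0 : 0 <= k%:R * g * pi / 3 by rewrite !mulr_ge0 ?invr_ge0.
have := inv_trace_bernoulli (coercive_outer w kp0 cB) g0 gw pi0.
rewrite -!addrA -!(scalerDl (w *m w^T)).
have -> : k%:R * g * pi / 3 + g * pi / 3 = k.+1%:R * g * pi / 3.
  by rewrite -(natr1 k); field.
apply: le_trans.
have kk : k%:R * g <= k.+1%:R * g by rewrite ler_wpM2r ?ler_nat.
have kp : k%:R * g * pi / 3 + g <= k.+1%:R * g.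
  rewrite -(natr1 k) mulrDl mul1r lerD2r.
  have : 0 <= k%:R * g * (1 - pi) by rewrite mulr_ge0.
  lra.
have kp0' : 0 <= k%:R * g * pi / 3 + g by rewrite addr_ge0.
have := inv_trace_mono w cB k0 kk; have := inv_trace_mono w cB kp0' kp.
rewrite exprS; have := exprn_ge0 k q0; have : (1 - pi) ^+ k <= 1.
  by rewrite exprn_ile1 // gerBl.
move: ((1 - pi) ^+ k) IH => Q.
set a := inv_trace _ B; set b := inv_trace _ (B + (k%:R * g) *: _).
set c := inv_trace _ (B + (k.+1%:R * g) *: _).
set e := inv_trace _ _; set f := inv_trace _ _ => IH Q1 Q0 cf cb.
have : (1 - Q) * c <= (1 - Q) * b by rewrite ler_wpM2l // subr_ge0.
have : pi * c <= pi * f by rewrite ler_wpM2l.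
have -> : (1 - pi) * Q * a + (1 - (1 - pi) * Q) * c =
   (1 - pi) * (Q * a + (1 - Q) * c) + pi * c by ring.
move=> h1 h2; apply: lerD => //; apply: ler_wpM2l => //; lra.
Qed.

End Bernoulli.

(** * Sums of independent random rank-one matrices *)

Definition ffun_upd (I : finType) (T : Type) (t : {ffun I -> T}) (i : I) (x : T) :=
  [ffun j => if j == i then x else t j].

(** * Replacement of independent coordinates one at a time *)

Section BernoulliProduct.
Variables (R : realDomainType) (n : nat) (p : 'I_n -> R).
Hypothesis p01 : forall i, 0 <= p i <= 1.
Implicit Types e : {ffun 'I_n -> bool}.

Definition bern_weight e : R := \prod_i (if e i then p i else 1 - p i).

Lemma bern_weight_ge0 e : 0 <= bern_weight e.
Proof.
apply: prodr_ge0 => i _; have /andP[p0 p1] := p01 i.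
by case: (e i) => //; rewrite subr_ge0.
Qed.

Lemma bern_weight_sum : \sum_e bern_weight e = 1.
Proof.
rewrite /bern_weight -(bigA_distr_bigA (fun i b => if b then p i else 1 - p i)) /=.
by apply: big1 => i _; rewrite big_bool /= addrC subrK.
Qed.

(** Flipping bit [i] is an involution that preserves the weight [W'] of the other bits, so the
    configurations can be averaged in pairs. *)
Lemma bern_sum_resample (G : {ffun 'I_n -> bool} -> R) i :
  \sum_e bern_weight e * G e = \sum_e bern_weight e *
    (p i * G (ffun_upd e i true) + (1 - p i) * G (ffun_upd e i false)).
Proof.
pose W' e : R := \prod_(j | j != i) (if e j then p j else 1 - p j).
have WE e : bern_weight e = (if e i then p i else 1 - p i) * W' e.
  by rewrite /bern_weight (bigD1 i).
pose flip e := ffun_upd e i (~~ e i).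
have flipK : involutive flip.
  move=> e; apply/ffunP => j; rewrite !ffunE eqxx; case: eqP => [->|] //.
  by rewrite negbK.
have W'flip e : W' (flip e) = W' e.
  by apply: eq_bigr => j ji; rewrite ffunE (negPf ji).
have flipi e : flip e i = ~~ e i by rewrite ffunE eqxx.
have updT e : e i -> ffun_upd e i true = e.
  by move=> ei; apply/ffunP => j; rewrite ffunE; case: eqP => [->|].
have updF e : ~~ e i -> ffun_upd e i false = e.
  by move=> /negPf ei; apply/ffunP => j; rewrite ffunE; case: eqP => [->|].
have updflip e b : ffun_upd (flip e) i b = ffun_upd e i b.
  by apply/ffunP => j; rewrite !ffunE; case: eqP.
pose S1 := \sum_(e : {ffun 'I_n -> bool} | e i) W' e * G e; pose S0 := \sum_(e : {ffun 'I_n -> bool} | ~~ e i) W' e * G e.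
have sumT : \sum_e W' e * G (ffun_upd e i true) = 2 * S1.
  rewrite (bigID (fun e : {ffun 'I_n -> bool} => e i)) /= mulr2n mulrDl !mul1r.
  congr (_ + _); first by apply: eq_bigr => e ei; rewrite updT.
  rewrite (reindex_inj (inv_inj flipK)); apply: eq_big => [e|e].
    by rewrite flipi negbK.
  by rewrite flipi negbK => ei; rewrite W'flip updflip updT.
have sumF : \sum_e W' e * G (ffun_upd e i false) = 2 * S0.
  rewrite (bigID (fun e : {ffun 'I_n -> bool} => e i)) /= mulr2n mulrDl !mul1r.
  congr (_ + _); last by apply: eq_bigr => e ei; rewrite updF.
  rewrite (reindex_inj (inv_inj flipK)); apply: eq_big => [e|e].
    by rewrite flipi.
  by rewrite flipi => ei; rewrite W'flip updflip updF.
have lhs : \sum_e bern_weight e * G e = p i * S1 + (1 - p i) * S0.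
  rewrite (bigID (fun e : {ffun 'I_n -> bool} => e i)) /= /S1 /S0 !mulr_sumr.
  congr (_ + _); apply: eq_bigr => e; rewrite WE mulrA.
    by move=> ->.
  by move=> /negPf ->.
have half H : (forall e, H (flip e) = H e) ->
    2 * \sum_e bern_weight e * H e = \sum_e W' e * H e.
  move=> Hf; rewrite mulr2n mulrDl !mul1r.
  rewrite [X in _ + X](reindex_inj (inv_inj flipK)) -big_split /=.
  apply: eq_bigr => e _; rewrite Hf !WE W'flip flipi.
  by case: (e i) => /=; ring.
apply: (mulfI (_ : 2 != 0 :> R)); first by rewrite pnatr_eq0.
rewrite lhs half => [|e]; last by rewrite !updflip.
under eq_bigr do rewrite mulrDr mulrCA [X in _ + X]mulrCA.
by rewrite big_split /= -!mulr_sumr sumT sumF; ring.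
Qed.

(** A hybrid argument: in [H k] the coordinates below [k] are already replaced by [c], and the
    others are still random. Resampling coordinate [k] isolates it, and the hypothesis on [F] bounds
    this one average for all nonnegative values of the others. *)
Lemma bern_sum_le (F : {ffun 'I_n -> R} -> R) (s c : 'I_n -> R) :
  (forall i, 0 <= s i) -> (forall i, 0 <= c i) ->
  (forall (t : {ffun 'I_n -> R}) i, (forall j, 0 <= t j) ->
     p i * F (ffun_upd t i (s i)) + (1 - p i) * F (ffun_upd t i 0) <=
     F (ffun_upd t i (c i))) ->
  \sum_e bern_weight e * F [ffun i => if e i then s i else 0] <= F [ffun i => c i].
Proof.
move=> s0 c0 hF.
pose H k e := F [ffun i : 'I_n => if (i < k)%N then c i else if e i then s i else 0].
have step k : (k < n)%N ->
    \sum_e bern_weight e * H k e <= \sum_e bern_weight e * H k.+1 e.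
  move=> kn; rewrite (bern_sum_resample _ (Ordinal kn)).
  apply: ler_sum => e _; apply: ler_wpM2l (bern_weight_ge0 e) _ _ _.
  set i := Ordinal kn.
  pose t := [ffun j : 'I_n => if (j < k)%N then c j else if e j then s j else 0].
  have t0 j : 0 <= t j by rewrite ffunE; case: ifP => // _; case: ifP.
  have := hF t i t0; rewrite /H.
  have -> : ffun_upd t i (s i) =
      [ffun j : 'I_n => if (j < k)%N then c j else
         if ffun_upd e i true j then s j else 0].
    by apply/ffunP => j; rewrite !ffunE; case: eqP => [->|//]; rewrite ltnn.
  have -> : ffun_upd t i 0 =
      [ffun j : 'I_n => if (j < k)%N then c j else
         if ffun_upd e i false j then s j else 0].
    by apply/ffunP => j; rewrite !ffunE; case: eqP => [->|//]; rewrite ltnn.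
  suff -> : ffun_upd t i (c i) =
      [ffun j : 'I_n => if (j < k.+1)%N then c j else if e j then s j else 0] by [].
  apply/ffunP => j; rewrite !ffunE; case: eqP => [->|/eqP ji]; first by rewrite leqnn.
  by rewrite ltnS [in RHS]leq_eqVlt -[(j : nat) == k]/(j == i) (negPf ji).
have all k : (k <= n)%N ->
    \sum_e bern_weight e * H 0%N e <= \sum_e bern_weight e * H k e.
  elim: k => // k IH kn; apply: le_trans (step k kn); exact/IH/ltnW.
have -> : F [ffun i => c i] = \sum_e bern_weight e * H n e.
  rewrite -[LHS]mul1r -bern_weight_sum mulr_suml; apply: eq_bigr => e _.
  by congr (_ * F _); apply/ffunP => i; rewrite !ffunE ltn_ord.
by apply: le_trans (all n (leqnn n)).
Qed.

End BernoulliProduct.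

(** * Lower tail of the random sum: matrix Chernoff bound *)

Section RandomSum.
Variables (R : archiRealFieldType) (d m n : nat) (delta : R).
Hypotheses (delta2 : 2 <= delta) (deltam : 2 * m%:R <= delta).
Variable f : 'I_n -> 'cV[R]_d.

Let delta0 : 0 < delta. Proof. by apply: lt_le_trans delta2. Qed.

(** The shift by [delta] makes every sum invertible and pieces of size at most one small in
    comparison. *)
Definition rank_one_sum (t : 'I_n -> R) : 'M[R]_d :=
  delta%:M + \sum_i t i *: (f i *m (f i)^T).

Lemma dot_rank_one_sum t x :
  dot x (rank_one_sum t *m x) = delta * dot x x + \sum_i t i * dot (f i) x ^+ 2.
Proof.
rewrite /rank_one_sum mulmxDl mul_scalar_mx dotDr dotZr; congr (_ + _).
rewrite mulmx_suml; elim/big_ind2: _ => [|y a z b ya zb|i _].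
- by rewrite dotC dot0l.
- by rewrite dotDr ya zb.
- by rewrite -scalemxAl mulmx_outer !dotZr (dotC x) expr2.
Qed.

Lemma coercive_rank_one_sum t : (forall i, 0 <= t i) ->
  coercive delta (rank_one_sum t).
Proof.
move=> t0; split=> [|x].
  rewrite /rank_one_sum linearD /= tr_scalar_mx linear_sum /=; congr (_ + _).
  by apply: eq_bigr => i _; rewrite linearZ /= trmx_mul trmxK.
by rewrite dot_rank_one_sum lerDl sumr_ge0 // => i _; rewrite mulr_ge0 // sqr_ge0.
Qed.

(* One coordinate of the random sum: the coefficient [s] occurs with
   probability [p], and [s] is the value of a sum of [k] independent steps [g],
   all of which fail with probability at least [1 - p]. *)
Definition bernoulli_step (p s c : R) (v : 'cV[R]_d) := exists (k : nat) (g pi : R),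
  [/\ 0 <= g, g * dot v v <= 1, 0 <= pi <= 1,
      s = k%:R * g & 1 - p <= (1 - pi) ^+ k /\ 0 <= c <= s * pi / 3].

Lemma bernoulli_step_inv_trace p s c v (B : 'M[R]_d) : coercive delta B ->
  bernoulli_step p s c v ->
  p * inv_trace m (B + s *: (v *m v^T)) + (1 - p) * inv_trace m B <=
  inv_trace m (B + c *: (v *m v^T)).
Proof.
move=> cB [k [g [pi [g0 gv pi01 -> [pk /andP[c0 cle]]]]]].
have := inv_trace_binomial delta2 deltam k cB g0 gv pi01.
have := inv_trace_mono delta2 deltam v cB c0 cle.
have kg : 0 <= k%:R * g by rewrite mulr_ge0.
have := inv_trace_mono delta2 deltam v cB (lexx 0) kg.
rewrite scale0r addr0.
set a := inv_trace _ B; set b := inv_trace _ (B + (k%:R * g) *: _).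
move: ((1 - pi) ^+ k) pk => Q pQ ba h1 h2; apply: le_trans h1; apply: le_trans h2.
have : 0 <= (a - b) * (Q - (1 - p)) by rewrite mulr_ge0 // subr_ge0.
lra.
Qed.

Variables p s c : 'I_n -> R.
Hypotheses (p01 : forall i, 0 <= p i <= 1) (s0 : forall i, 0 <= s i).
Hypothesis step : forall i, bernoulli_step (p i) (s i) (c i) (f i).

Let c0 i : 0 <= c i.
Proof. by have [k [g [pi [_ _ _ _ [_ /andP[]]]]]] := step i. Qed.

Lemma expect_inv_trace_le :
  \sum_e bern_weight p e *
    inv_trace m (rank_one_sum (fun i => if e i then s i else 0)) <=
  inv_trace m (rank_one_sum c).
Proof.
pose F (t : {ffun 'I_n -> R}) := inv_trace m (rank_one_sum t).
have Fext t t' : t =1 t' -> inv_trace m (rank_one_sum t) = inv_trace m (rank_one_sum t').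
  by move=> tt'; congr (inv_trace m (_ + _)); apply: eq_bigr => i _; rewrite tt'.
have := @bern_sum_le _ _ _ p01 F s c s0 c0.
rewrite /F (Fext _ c) => [|i]; last by rewrite ffunE.
under eq_bigr do rewrite (Fext _ _ (ffunE _)).
apply => t i t0.
have upd x : rank_one_sum (ffun_upd t i x) =
    rank_one_sum (ffun_upd t i 0) + x *: (f i *m (f i)^T).
  rewrite /rank_one_sum -addrA; congr (_ + _).
  rewrite (bigD1 i) // [in RHS](bigD1 i) //= !ffunE eqxx scale0r add0r addrC.
  by congr (_ + _); apply: eq_bigr => j /negPf ji; rewrite !ffunE ji.
rewrite (upd (s i)) (upd (c i)); apply: bernoulli_step_inv_trace (step i).
by apply: coercive_rank_one_sum => j; rewrite ffunE; case: ifP.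
Qed.

Hypothesis c_lower : forall x, 3 * delta * dot x x <= \sum_i c i * dot (f i) x ^+ 2.

Definition bern_good (e : {ffun 'I_n -> bool}) : bool :=
  inv_trace m (rank_one_sum (fun i => if e i then s i else 0)) <=
  (2 * delta)^-1 ^+ m.

(** Markov's inequality. With the shift, the deterministic sum is at least [3 delta + delta], so the
    mean potential is at most [d (4 delta)^-m], whereas a bad configuration exceeds
    [(2 delta)^-m]. *)
Lemma bern_bad_le : \sum_(e | ~~ bern_good e) bern_weight p e <= d%:R / 2 ^+ m.
Proof.
have C4 : coercive (4 * delta) (rank_one_sum c).
  split=> [|x]; first by case: (coercive_rank_one_sum c0).
  by rewrite dot_rank_one_sum; have := c_lower x; lra.
have d4 : 0 < 4 * delta by rewrite mulr_gt0.
have d2 : 0 < 2 * delta by rewrite mulr_gt0.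
have := le_trans expect_inv_trace_le (trace_invmx_exp_le m d4 C4).
have W0 := bern_weight_ge0 p01.
have c_if (e : {ffun 'I_n -> bool}) i : 0 <= (if e i then s i else 0).
  by case: ifP.
have T0 (e : {ffun 'I_n -> bool}) : 0 <= inv_trace m
    (rank_one_sum (fun i => if e i then s i else 0)).
  have [_ P0] := possemi_exp m (invmx_possemi delta0
    (coercive_rank_one_sum (c_if e))).
  apply: sumr_ge0 => i _; have := P0 (delta_mx i 0).
  by rewrite /dot trmx_delta mulmxA -rowE -colE !mxE.
rewrite (bigID bern_good) /= => h.
have {}h : \sum_(e | ~~ bern_good e) bern_weight p e * (2 * delta)^-1 ^+ m <=
    d%:R * (4 * delta)^-1 ^+ m.
  apply: le_trans h; apply: ler_wpDl; first by apply: sumr_ge0 => e _; rewrite mulr_ge0.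
  by apply: ler_sum => e; rewrite -ltNge => /ltW; apply: ler_wpM2l.
rewrite -(ler_pM2r (_ : 0 < (2 * delta)^-1 ^+ m)); last first.
  by rewrite exprn_gt0 // invr_gt0.
rewrite mulr_suml; apply: le_trans h _.
rewrite -mulrA ler_wpM2l // -exprVn -exprMn -invfM.
by rewrite (_ : 4 * delta = 2 * (2 * delta)) //; ring.
Qed.

(** A good potential forces the shifted sum to be at least [2 delta], and the shift accounts for
    only one [delta] of it. *)
Lemma bern_good_lower e x : (0 < m)%N -> bern_good e ->
  delta * dot x x <= \sum_i (if e i then s i * dot (f i) x ^+ 2 else 0).
Proof.
move=> m0 good; have t0 i : 0 <= (if e i then s i else 0) by case: ifP.
have d2 : 0 < 2 * delta by rewrite mulr_gt0.
move: good; rewrite /bern_good -(prednK m0) => good.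
have [_ /(_ x)] := coercive_of_trace delta0 (coercive_rank_one_sum t0) d2 good.
rewrite dot_rank_one_sum -mulrA mulr2n mulrDl mul1r lerD2l => /le_trans; apply.
by apply: ler_sum => i _; case: ifP => // _; rewrite mul0r.
Qed.

End RandomSum.

(** * Lewis weights *)

Section PowerInequalities.
Variable R : realType.
Implicit Types (a b q r x y c p : R).

Lemma young_powR a b r : 0 < r < 1 -> 0 <= a -> 0 <= b ->
  a `^ r * b `^ (1 - r) <= r * a + (1 - r) * b.
Proof.
move=> /andP[r0 r1] a0 b0; have s0 : 0 < 1 - r by rewrite subr_gt0.
have := @conjugate_powR R (a `^ r) (b `^ (1 - r)) r^-1 (1 - r)^-1.
rewrite !powR_ge0 !invr_gt0 !invrK -!powRrM !mulfV ?gt_eqF // !powRr1 //.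
by rewrite (mulrC a) (mulrC b); apply => //; rewrite addrC subrK.
Qed.

Lemma powR_tangent q x r : 0 < r < 1 -> 0 < q -> 0 <= x ->
  x `^ r <= q `^ r + r * q `^ (r - 1) * (x - q).
Proof.
move=> r01 q0 x0; have qr0 : 0 < q `^ (1 - r) by rewrite powR_gt0.
rewrite -(ler_pM2r qr0); apply: le_trans (young_powR r01 x0 (ltW q0)) _.
have E1 : q `^ r * q `^ (1 - r) = q.
  by rewrite -powRD ?(gt_eqF q0) ?implybT // addrC subrK powRr1 // ltW.
have E2 : q `^ (r - 1) * q `^ (1 - r) = 1.
  rewrite -powRD ?(gt_eqF q0) ?implybT //.
  by rewrite (_ : r - 1 + (1 - r) = 0) ?powRr0 //; ring.
have -> : (q `^ r + r * q `^ (r - 1) * (x - q)) * q `^ (1 - r) =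
  q `^ r * q `^ (1 - r) + r * (x - q) * (q `^ (r - 1) * q `^ (1 - r)) by ring.
by rewrite E1 E2; lra.
Qed.

Lemma powR_ge1 a r : 1 <= a -> 0 <= r -> 1 <= a `^ r.
Proof. by move=> a1 r0; rewrite -[leLHS](powRr0 a) ler_powR. Qed.

Lemma powR_le1 a r : 0 <= a <= 1 -> 0 <= r -> a `^ r <= 1.
Proof.
move=> /andP[a0 a1] r0; rewrite -[leRHS](congr1 (fun f => f r) (powR1 R)).
by apply: ge0_ler_powR; rewrite ?nnegrE.
Qed.

(** The power [p / 2] below 1 is that of Lewis weights. Above 1 slower growth is needed: an index
    with [u_i <= psi q_i] has [D_ii^2 >= (psi q_i)^(-2/p)], which has to dominate [psi' q_i]. For
    growth [q^a] this means [a - 1 <= - 2 a / p], and [a = 1/3] is the largest exponent that serves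
    all [p >= 1]. *)
Definition psi p q := Num.min (q `^ (p / 2)) (q `^ 3^-1).
(** A supergradient of [psi] at positive points; where the branches meet, the left derivative is
    taken. At 0 its value is 0, because [powR] sends 0 to 0 for nonzero exponents. *)
Definition psi' p q :=
  if q <= 1 then p / 2 * q `^ (p / 2 - 1) else 3^-1 * q `^ (3^-1 - 1).

Variable p : R.
Hypotheses (p1 : 1 <= p) (p2 : p < 2).

Let p2_01 : 0 < p / 2 < 1. Proof. by have := p1; have := p2 => *; apply/andP; split; lra. Qed.

Lemma psi_le1 q : 0 <= q <= 1 -> psi p q = q `^ (p / 2).
Proof.
have := p1; have := p2 => hp2 hp1.
move=> /andP[q0 q1]; apply/min_idPl; move: q0; rewrite [0 <= q]le_eqVlt => /predU1P[<-|q0].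
  by rewrite !powR0 // gt_eqF //; lra.
by apply: ger_powR; [rewrite q0|lra].
Qed.

Lemma psi_ge1 q : 1 <= q -> psi p q = q `^ 3^-1.
Proof. by move=> q1; apply/min_idPr; apply: ler_powR => //; have := p1; lra. Qed.

Lemma psi_ge0 q : 0 <= psi p q.
Proof. by rewrite le_min !powR_ge0. Qed.

Lemma psi'_ge0 q : 0 <= psi' p q.
Proof.
have := p1; have := p2 => hp2 hp1.
by rewrite /psi'; case: ifP => _; rewrite mulr_ge0 ?powR_ge0 //; lra.
Qed.

(* [psi] is a minimum of two concave functions, so the tangent of either at a
   point where it attains the minimum dominates. *)
Lemma psi_tangent q x : 0 <= q -> 0 <= x -> (q = 0 -> x = 0) ->
  psi p x <= psi p q + psi' p q * (x - q).
Proof.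
have := p1; have := p2 => hp2 hp1.
move=> q0 x0 qx; move: q0; rewrite [0 <= q]le_eqVlt => /predU1P[q0|q0].
  by rewrite -q0 qx // subrr mulr0 addr0.
rewrite /psi'; case: (leP q 1) => q1.
  rewrite (@psi_le1 q) ?(ltW q0) //.
  by apply: le_trans (powR_tangent p2_01 q0 x0); rewrite ge_min lexx.
rewrite (@psi_ge1 q) ?(ltW q1) //.
have r01 : 0 < (3^-1 : R) < 1.
  by apply/andP; split; lra.
by apply: le_trans (powR_tangent r01 q0 x0); rewrite ge_min lexx orbT.
Qed.

(** As [1/3 <= p/2], both branches shrink at least at the rate [1/3]. This tells how far a matrix
    has to be shrunk to meet the cost constraint again. *)
Lemma psiM_le1 c q : 0 < c <= 1 -> 0 <= q -> psi p (c * q) <= c `^ 3^-1 * psi p q.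
Proof.
have := p1; have := p2 => hp2 hp1.
move=> c01 q0; have c0 : 0 <= c by case/andP: c01 => /ltW.
rewrite /psi minr_pMr ?powR_ge0 // le_min !ge_min.
apply/andP; split; apply/orP; [left|right]; rewrite powRM // ler_wpM2r ?powR_ge0 //.
by apply: ger_powR => //; lra.
Qed.

Lemma psiM_ge1 c q : 1 <= c -> 0 <= q -> psi p (c * q) <= c * psi p q.
Proof.
have := p1; have := p2 => hp2 hp1.
move=> c1 q0; have c0 : 0 <= c by apply: le_trans c1.
rewrite /psi minr_pMr // le_min !ge_min.
apply/andP; split; apply/orP; [left|right]; rewrite powRM // ler_wpM2r ?powR_ge0 //;
 by apply: ler1_powR => //; lra.
Qed.

Lemma psi'M_le q : 0 <= q -> psi' p q * q <= psi p q.
Proof.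
have := p1; have := p2 => hp2 hp1.
rewrite [0 <= q]le_eqVlt => /predU1P[<-|q0]; first by rewrite mulr0 psi_ge0.
have E r : 0 < r -> q `^ (r - 1) * q = q `^ r.
  by move=> r0; rewrite mulrC mulr_powRB1 // ltW.
rewrite /psi'; case: (leP q 1) => q1; rewrite -mulrA E; try lra.
  by rewrite psi_le1 ?(ltW q0) // ler_piMl ?powR_ge0 //; lra.
by rewrite psi_ge1 ?(ltW q1) // ler_piMl ?powR_ge0 //; lra.
Qed.

Lemma psi'_le q : 0 < q -> psi' p q <= q `^ (p / 2 - 1).
Proof.
have := p1; have := p2 => hp2 hp1.
move=> q0; rewrite /psi'; case: (leP q 1) => q1.
  by rewrite ler_piMl ?powR_ge0 //; lra.
apply: (@le_trans _ _ (q `^ (3^-1 - 1))).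
  by rewrite ler_piMl ?powR_ge0 //; lra.
by apply: ler_powR; lra.
Qed.

(** Sublevel sets of [psi] are bounded, which makes the determinants in the maximisation bounded. *)
Lemma psi_inv_le q b : 0 <= q -> psi p q <= b -> q <= 1 + b ^+ 3.
Proof.
have := p1; have := p2 => hp2 hp1.
move=> q0 qb; have b0 : 0 <= b by apply: le_trans qb; exact: psi_ge0.
have [q1|/ltW q1] := leP q 1; first by rewrite ler_wpDr // exprn_ge0.
apply: ler_wpDl => //; move: qb; rewrite psi_ge1 // => qb.
have E3 : (q `^ 3^-1) ^+ 3 = q.
  by rewrite -powR_mulrn ?powR_ge0 // -powRrM mulVf ?pnatr_eq0 // powRr1.
by rewrite -[leLHS]E3 lerXn2r ?nnegrE ?powR_ge0.
Qed.

End PowerInequalities.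

(** Conjugation of the block triangular [M] by a unit lower triangular matrix moves the rank-one
    term from the upper left block to the lower right one. *)
Lemma det_1D_outer (R : comNzRingType) (d : nat) (u v : 'cV[R]_d) :
  \det (1%:M + u *m v^T) = 1 + dot v u.
Proof.
pose L := block_mx (1%:M : 'M[R]_d) 0 v^T (1%:M : 'M[R]_1).
pose L' := block_mx (1%:M : 'M[R]_d) 0 (- v^T) (1%:M : 'M[R]_1).
pose M := block_mx (1%:M + u *m v^T) u 0 (1%:M : 'M[R]_1).
have dM : \det M = \det (1%:M + u *m v^T) by rewrite det_ublock det1 mulr1.
have : L *m M *m L' = block_mx 1%:M u 0 (1%:M + v^T *m u).
  rewrite /L /M /L' !mulmx_block !mul1mx !mulmx1 !mul0mx !mulmx0 !addr0 !add0r.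
  congr block_mx; first by rewrite mulmxN addrK.
    by rewrite mulmxDr mulmx1 mulmxN mulmxDl mul1mx mulmxA [X in _ - X]addrC subrr.
  by rewrite addrC.
move=> /(congr1 determinant).
rewrite !det_mulmx dM !det_lblock det_ublock !det1 !mul1r !mulr1 => ->.
by rewrite [X in \det X]mx11_scalar det_scalar1 mxE mxE eqxx.
Qed.

Definition rowv (R : Type) (n d : nat) (F : 'M[R]_(n, d)) (i : 'I_n) : 'cV[R]_d :=
  (row i F)^T.

(** * Near-maximal determinant under the cost constraint *)

Section Weights.
Variables (R : realType) (p L : R) (n d : nat) (A : 'M[R]_(n, d)) (K : R).
Hypotheses (p1 : 1 <= p) (p2 : p < 2) (L0 : 0 < L) (d0 : (0 < d)%N).
Hypothesis AK : forall (x : 'cV[R]_d) b, 0 <= b ->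
  (forall i, `|(A *m x) i 0| <= b) -> forall k, `|x k 0| <= K * b.
Implicit Types U F : 'M[R]_d.

Definition row_sqr m (F : 'M[R]_(m, d)) i := dot (rowv F i) (rowv F i).

Let Lam := d%:R * L.
Let Lam0 : 0 < Lam. Proof. by rewrite mulr_gt0 ?ltr0n. Qed.
Let cost U := \sum_i psi p (row_sqr (A *m U) i).
Let S : set R := [set r | exists2 U, cost U <= Lam & r = `|\det U| ].

Let row_sqr_ge0 m (F : 'M[R]_(m, d)) i : 0 <= row_sqr F i.
Proof. exact: dot_ge0. Qed.

Let row_sqrZ m (F : 'M[R]_(m, d)) c i : row_sqr (c *: F) i = c ^+ 2 * row_sqr F i.
Proof.
by rewrite /row_sqr /rowv linearZ linearZ /= dotZl dotZr mulrA.
Qed.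

(** The constraint bounds every row of [A U], hence by [AK] every entry of [U], hence the
    determinant through its expansion over permutations. *)
Let S_bounded : has_ubound S.
Proof.
pose b := 2 + Lam ^+ 3; have b1 : 1 <= b by have := exprn_ge0 3 (ltW Lam0); rewrite /b; lra.
exists (\sum_(s : 'S_d) \prod_(i < d) (`|K| * b)) => _ [U cU ->].
rewrite /determinant; apply: le_trans (ler_norm_sum _ _ _) _.
apply: ler_sum => s _; rewrite normrM normrX normrN1 expr1n mul1r normr_prod.
apply: ler_prod => i _; rewrite normr_ge0 /=.
have Ucol j k : `|U k j| <= `|K| * b.
  have b0 : 0 <= b by lra.
  have -> : U k j = col j U k 0 by rewrite mxE.
  apply: le_trans (AK b0 _ k) (ler_wpM2r b0 (ler_norm K)) => l.
  have -> : (A *m col j U) l 0 = (A *m U) l j.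
    by rewrite !mxE; apply: eq_bigr => i' _; rewrite mxE.
  have qb : row_sqr (A *m U) l <= b.
    have := psi_inv_le p1 p2 (row_sqr_ge0 (A *m U) l).
    move=> /(_ Lam); rewrite /b; suff h : psi p (row_sqr (A *m U) l) <= Lam.
      by move=> /(_ h); lra.
    apply: le_trans cU; rewrite /cost (bigD1 l) //= lerDl.
    by apply: sumr_ge0 => i' _; apply: psi_ge0.
  rewrite -(ler_pXn2r (ltn0Sn 1)) ?nnegrE ?normr_ge0 // real_normK ?num_real //.
  apply: (@le_trans _ _ (row_sqr (A *m U) l)); last by apply: le_trans qb _; nra.
  rewrite /row_sqr dotE (bigD1 j) //= /rowv !mxE -expr2 lerDl.
  by apply: sumr_ge0 => j' _; rewrite !mxE -expr2 sqr_ge0.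
exact: Ucol.
Qed.

Let cost_scale U c : 0 < c <= 1 -> cost (c *: U) <= (c ^+ 2) `^ 3^-1 * cost U.
Proof.
move=> /andP[c0 c1]; rewrite /cost mulr_sumr; apply: ler_sum => i _.
rewrite -scalemxAr row_sqrZ; apply: psiM_le1 => //.
by rewrite exprn_gt0 //= exprn_ile1 // ltW.
Qed.

Let cost_scale_ge1 U c : 1 <= c -> cost (c *: U) <= c ^+ 2 * cost U.
Proof.
move=> c1; rewrite /cost mulr_sumr; apply: ler_sum => i _.
by rewrite -scalemxAr row_sqrZ; apply: psiM_ge1 => //; rewrite exprn_ege1.
Qed.

Let near_max : exists U, [/\ cost U <= Lam, 0 < `|\det U| &
  forall U', cost U' <= Lam -> `|\det U'| <= 4 / 3 * `|\det U| ].
Proof.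
pose y := Lam / (1 + cost 1%:M).
have cost0 U : 0 <= cost U by apply: sumr_ge0 => i _; apply: psi_ge0.
have den : 0 < 1 + cost 1%:M by rewrite ltr_pwDl.
have y0 : 0 < y by rewrite divr_gt0.
(* The scalar matrix [c] satisfies the constraint because [(c^2)^(1/3) <= y]. It makes the supremum
   positive, so that a quarter of it is a legitimate error; this is the origin of the ratio
   [4/3]. *)
pose c := Num.min 1 (y `^ (3 / 2)).
have c0 : 0 < c by rewrite lt_min ltr01 powR_gt0.
have c1 : c <= 1 by rewrite ge_min lexx.
have cS : cost (c%:M) <= Lam.
  rewrite -scalemx1; apply: le_trans (cost_scale _ _) _; first by rewrite c0.
  have : (c ^+ 2) `^ 3^-1 <= y.
    have -> : y = ((y `^ (3 / 2)) ^+ 2) `^ 3^-1.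
      rewrite -powR_mulrn ?powR_ge0 // -!powRrM (_ : 3 / 2 * _ = 1) ?powRr1 //.
        exact: ltW.
      by field.
    apply: ge0_ler_powR; rewrite ?nnegrE ?invr_ge0 ?exprn_ge0 ?powR_ge0 ?(ltW c0) //.
    by rewrite lerXn2r ?nnegrE ?powR_ge0 ?(ltW c0) // ge_min lexx orbT.
  move=> /(ler_wpM2r (cost0 1%:M)) h; apply: le_trans h _.
  rewrite /y mulrAC ler_pdivrMr // ler_wpM2l ?(ltW Lam0) //; lra.
have Sc : S (c ^+ d).
  by exists c%:M => //; rewrite det_scalar ger0_norm // exprn_ge0 // ltW.
have supS : has_sup S by split => //; exists (c ^+ d).
have sup0 : 0 < sup S.
  by apply: lt_le_trans (ub_le_sup S_bounded Sc); rewrite exprn_gt0.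
have sup4 : 0 < sup S / 4 by rewrite divr_gt0.
have [_ [U cU ->] hU] := sup_adherent sup4 supS.
have hU' : 3 / 4 * sup S < `|\det U| by lra.
exists U; split=> // [|U' cU']; first by lra.
have : `|\det U'| <= sup S by apply: (ub_le_sup S_bounded); exists U'.
lra.
Qed.

Let form (F : 'M[R]_(n, d)) (e : 'cV[R]_d) :=
  \sum_i psi' p (row_sqr F i) * dot (rowv F i) e ^+ 2.

(** Stretching by [1 + s] along the unit vector [e] adds [(2 s + s^2) <f_i, e>^2] to [|f_i|^2]. The
    tangent inequality for [psi] bounds the new cost by an expression linear in the form. *)
Let cost_stretch U e s : -1 <= s -> dot e e = 1 -> cost U <= Lam ->
  cost (U *m (1%:M + (s *: e) *m e^T)) <=
  Lam + (2 * s + s ^+ 2) * form (A *m U) e.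
Proof.
move=> s1 e1 cU; apply: (@le_trans _ _ (cost U + (2 * s + s ^+ 2) * form (A *m U) e)).
  rewrite /cost /form mulr_sumr -big_split /=; apply: ler_sum => i _.
  set q := row_sqr (A *m U) i; set v := rowv (A *m U) i.
  have -> : row_sqr (A *m (U *m (1%:M + s *: e *m e^T))) i =
      q + (2 * s + s ^+ 2) * dot v e ^+ 2.
    rewrite {1}/row_sqr; have -> : rowv (A *m (U *m (1%:M + s *: e *m e^T))) i = v + (s * dot v e) *: e.
      rewrite /v /rowv mulmxA row_mul trmx_mul linearD /= trmx1 trmx_mul trmxK.
      by rewrite mulmxDl mul1mx mulmx_outer dotZl (dotC e).
    rewrite !(dotDl, dotDr, dotZl, dotZr) e1 (dotC e) -[dot v v]/q.
    by ring.
  have cs : dot v e ^+ 2 <= q.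
    by have := cauchy_schwarz v e; rewrite e1 mulr1.
  have q0 : 0 <= q := row_sqr_ge0 _ _; have ve0 := sqr_ge0 (dot v e).
  set t := 2 * s + s ^+ 2; have t1 : -1 <= t by rewrite /t; nra.
  have q't : 0 <= q + t * dot v e ^+ 2 by nra.
  apply: le_trans (psi_tangent p1 p2 q0 q't _) _; last by rewrite addrAC subrr add0r; lra.
  by move=> q_eq0; move: cs; rewrite q_eq0 => cs; nra.
by rewrite lerD2r.
Qed.

Let det_stretch U e s : dot e e = 1 ->
  \det (U *m (1%:M + (s *: e) *m e^T)) = \det U * (1 + s).
Proof. by move=> e1; rewrite det_mulmx det_1D_outer dotZr e1 mulr1. Qed.

Let expX (x : R) : expR x ^+ d = expR (d%:R * x).
Proof. by rewrite expRM_natl. Qed.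

(* Near maximality is tested against the stretches of [U] by the factors
   [2] and [1/2] in the direction [e], rescaled to meet the constraint. *)
Let form_bounds U e : cost U <= Lam -> 0 < `|\det U| ->
  (forall U', cost U' <= Lam -> `|\det U'| <= 4 / 3 * `|\det U| ) ->
  dot e e = 1 -> L / 14 <= form (A *m U) e <= 5 * L.
Proof.
move=> cU detU maxU e1; set b := form (A *m U) e.
have b0 : 0 <= b.
  by apply: sumr_ge0 => i _; rewrite mulr_ge0 ?psi'_ge0 // sqr_ge0.
have dR : 0 < d%:R :> R by rewrite ltr0n.
have stretch s c : -1 <= s -> 0 <= c ->
    cost (c *: (U *m (1%:M + (s *: e) *m e^T))) <= Lam ->
    c ^+ d * `|1 + s| <= 4 / 3.
  move=> s1 c0 /maxU; rewrite detZ det_stretch // !normrM mulrCA mulrC.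
  by rewrite ler_pM2r // normrX (ger0_norm c0).
have cost_ge0 U' : 0 <= cost U' by apply: sumr_ge0 => i _; apply: psi_ge0.
apply/andP; split.
  (* For [s = 1] the cost grows by at most [3 b], that is, at most to [Lam * expR x]. Shrinking by
     [c] compensates exactly, since [(c^2)^(1/3) = expR (- x)]. *)
  set x := 3 * b / Lam; have x0 : 0 <= x by rewrite divr_ge0 ?(ltW Lam0) // mulr_ge0.
  pose c := expR (- (3 / 2 * x)); have c0 : 0 < c := expR_gt0 _.
  have := stretch 1 c; rewrite -/c => /(_ _ (ltW c0)) h.
  have : c ^+ d * `|1 + 1| <= 4 / 3.
    apply: h; first by lra.
    apply: le_trans (cost_scale _ _) _.
      by rewrite c0 -[leRHS]expR0 ler_expR; lra.
    have -> : (c ^+ 2) `^ 3^-1 = expR (- x).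
      rewrite /c -expRM_natl /powR expR_eq0 expRK mulrN; congr expR; by field.
    have le1 : cost (U *m (1%:M + (1 *: e) *m e^T)) <= Lam * expR x.
      apply: le_trans (cost_stretch _ e1 cU) _; first by lra.
      apply: (@le_trans _ _ (Lam * (1 + x))).
        by rewrite mulrDr mulr1 lerD2l /x -/b mulrCA divff ?gt_eqF // mulr1; lra.
      by rewrite ler_wpM2l ?(ltW Lam0) // expR_ge1Dx.
    apply: le_trans (ler_wpM2l (expR_ge0 _) le1) _.
    by rewrite mulrCA -expRD addNr expR0 mulr1.
  rewrite /c expX.
  have := expR_ge1Dx (d%:R * - (3 / 2 * x)).
  have -> : d%:R * - (3 / 2 * x) = - (9 / 2 * (b / L)).
    by rewrite /x /Lam; field; rewrite !gt_eqF.
  rewrite (_ : 1 + 1 = 2) ?ger0_norm // => h1 h2.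
  (* The value [2/27] is slightly more than the required [1/14]. *)
  have : 2 / 27 <= b / L by move: (b / L) h1 h2 => y; lra.
  by rewrite ler_pdivlMr //; have := L0; lra.
(* For [s = - 1/2] the cost is at most [Lam - 3 b / 4], which leaves room to enlarge by [c], where
   [c^2 = expR x]. The outcome is [b / L <= 40/9]. *)
set x := 3 / 4 * b / Lam.
have x0 : 0 <= x by rewrite divr_ge0 ?(ltW Lam0) // mulr_ge0 //; lra.
pose c := expR (x / 2); have c0 : 0 < c := expR_gt0 _.
have c1 : 1 <= c by rewrite -[leLHS]expR0 ler_expR; lra.
have := stretch (- 2^-1) c; move=> /(_ _ (ltW c0)) h.
have : c ^+ d * `|1 - 2^-1| <= 4 / 3.
  apply: h; first by lra.
  apply: le_trans (cost_scale_ge1 _ c1) _.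
  have -> : c ^+ 2 = expR x.
    by rewrite /c -expRM_natl; congr expR; field.
  have le1 : cost (U *m (1%:M + (- 2^-1 *: e) *m e^T)) <= Lam * expR (- x).
    apply: le_trans (cost_stretch _ e1 cU) _; first by lra.
    apply: (@le_trans _ _ (Lam * (1 + - x))).
      have -> : Lam * (1 - x) = Lam - 3 / 4 * b by rewrite /x; field; rewrite gt_eqF.
      by rewrite -/b; lra.
    by rewrite ler_wpM2l ?(ltW Lam0) // expR_ge1Dx.
  apply: le_trans (ler_wpM2l (expR_ge0 _) le1) _.
  by rewrite mulrCA -expRD subrr expR0 mulr1.
rewrite /c expX; have := expR_ge1Dx (d%:R * (x / 2)).
have -> : d%:R * (x / 2) = 3 / 8 * (b / L).
  by rewrite /x /Lam; field; rewrite !gt_eqF.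
rewrite ger0_norm => [|]; last by lra.
move=> h1 h2; have : b / L <= 40 / 9 by move: (b / L) h1 h2 => y; lra.
by rewrite ler_pdivrMr //; have := L0; lra.
Qed.

Lemma lewis_weights : exists U : 'M[R]_d, [/\ U \in unitmx,
  \sum_i psi p (row_sqr (A *m U) i) <= d%:R * L &
  forall x : 'cV[R]_d, L / 14 * dot x x <=
    \sum_i psi' p (row_sqr (A *m U) i) * dot (rowv (A *m U) i) x ^+ 2 <=
    5 * L * dot x x].
Proof.
have [U [cU detU maxU]] := near_max; exists U; split=> // [|x].
  by rewrite unitmxE unitfE -normr_gt0.
have [->|x0] := eqVneq x 0.
  rewrite dot0l !mulr0 big1 ?lexx // => i _.
  by rewrite dotC dot0l expr0n mulr0.
have xx := dot_gt0 x0; set r := Num.sqrt (dot x x).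
have r0 : 0 < r by rewrite sqrtr_gt0.
have r2 : r ^+ 2 = dot x x by rewrite sqr_sqrtr ?ltW.
have e1 : dot (r^-1 *: x) (r^-1 *: x) = 1.
  by rewrite dotZl dotZr -r2; field; rewrite gt_eqF.
have := form_bounds cU detU maxU e1.
have -> : form (A *m U) (r^-1 *: x) = (dot x x)^-1 *
    \sum_i psi' p (row_sqr (A *m U) i) * dot (rowv (A *m U) i) x ^+ 2.
  rewrite /form mulr_sumr; apply: eq_bigr => i _.
  by rewrite dotZr exprMn exprVn r2 mulrCA.
by rewrite [_^-1 * _]mulrC ler_pdivlMr // ler_pdivrMr.
Qed.

End Weights.

(** * Deterministic distortion bounds *)

(** Young's inequality for terms normalised by their sums. A vanishing sum rules out this
    normalisation, but then all terms on the left vanish. *)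
Lemma holder_sum (R : realType) (I : finType) (Q : pred I) (x w : I -> R) (r : R) :
  0 < r < 1 -> (forall i, 0 <= x i) -> (forall i, 0 <= w i) ->
  \sum_(i | Q i) x i `^ r * w i `^ (1 - r) <=
  (\sum_(i | Q i) x i) `^ r * (\sum_(i | Q i) w i) `^ (1 - r).
Proof.
move=> r01 x0 w0; have [r0 r1] := andP r01.
set X := \sum_(i | Q i) x i; set W := \sum_(i | Q i) w i.
have X0 : 0 <= X by apply: sumr_ge0.
have W0 : 0 <= W by apply: sumr_ge0.
have rhs0 : 0 <= X `^ r * W `^ (1 - r) by rewrite mulr_ge0 ?powR_ge0.
have [X00|Xn0] := eqVneq X 0.
  rewrite big1 // => i Qi; have /eqP := X00.
  rewrite /X psumr_eq0 // => /allP/(_ i (mem_index_enum _)); rewrite Qi /= => /eqP ->.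
  by rewrite powR0 ?mul0r // gt_eqF.
have [W00|Wn0] := eqVneq W 0.
  rewrite big1 // => i Qi; have /eqP := W00.
  rewrite /W psumr_eq0 // => /allP/(_ i (mem_index_enum _)); rewrite Qi /= => /eqP ->.
  by rewrite powR0 ?mulr0 // gt_eqF // subr_gt0.
have Xp : 0 < X by rewrite lt_def Xn0.
have Wp : 0 < W by rewrite lt_def Wn0.
have c0 : 0 < X `^ r * W `^ (1 - r) by rewrite mulr_gt0 ?powR_gt0.
have E1 : \sum_(i | Q i) (r * (x i / X) + (1 - r) * (w i / W)) = 1.
  by rewrite big_split /= -!mulr_sumr -!mulr_suml -/X -/W !divff //; ring.
have -> : X `^ r * W `^ (1 - r) = \sum_(i | Q i)
    X `^ r * W `^ (1 - r) * (r * (x i / X) + (1 - r) * (w i / W)).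
  by rewrite -mulr_sumr E1 mulr1.
apply: ler_sum => i _.
have := young_powR r01 (divr_ge0 (x0 i) X0) (divr_ge0 (w0 i) W0).
move=> /(ler_wpM2l (ltW c0)); apply: le_trans.
have E (z Z s : R) : 0 <= z -> 0 < Z -> z `^ s = Z `^ s * (z / Z) `^ s.
  move=> z0 Z0; rewrite -powRM ?(ltW Z0) ?divr_ge0 ?(ltW Z0) //.
  by rewrite mulrC divfK // gt_eqF.
by rewrite {1}(E (x i) X r) // {1}(E (w i) W (1 - r)) // mulrACA.
Qed.

Section Deterministic.
Variables (R : realType) (p L : R) (n d : nat) (F : 'M[R]_(n, d)).
Hypotheses (p1 : 1 <= p) (p2 : p < 2) (L14 : 14 <= L).
Let q := row_sqr F.
Let lam i := psi p (q i).
Hypothesis lam_sum : \sum_i lam i <= d%:R * L.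
Hypothesis form_le : forall x : 'cV[R]_d, L / 14 * dot x x <=
    \sum_i psi' p (q i) * dot (rowv F i) x ^+ 2 <= 5 * L * dot x x.

Let q0 i : 0 <= q i. Proof. exact: dot_ge0. Qed.
Let lam0 i : 0 <= lam i. Proof. exact: psi_ge0. Qed.
Let p0 : 0 < p. Proof. by apply: lt_le_trans p1. Qed.

Variable z : 'cV[R]_d.
Let y i := dot (rowv F i) z.
Let P := \sum_i `|y i| `^ p.
Let P0 : 0 <= P. Proof. by apply: sumr_ge0 => i _; apply: powR_ge0. Qed.

Let y_q i : y i ^+ 2 <= q i * dot z z.
Proof. exact: cauchy_schwarz. Qed.

(** As [L >= 14], the form dominates [|z|^2]. In each term [psi' q <= q^(p/2 - 1)], and since this
    exponent is negative, [y^2 <= q |z|^2] turns the term into at most [|z|^(2-p) |y|^p]. *)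
Lemma dot_le_sum_powR : dot z z `^ (p / 2) <= P.
Proof.
have hp1 := p1; have hp2 := p2; have hL := L14.
set Z := dot z z; have [Z0|Zn0] := eqVneq Z 0.
  by rewrite Z0 powR0 // gt_eqF //; lra.
have Zp : 0 < Z by rewrite lt_def Zn0 dot_ge0.
have key : Z <= Z `^ (1 - p / 2) * P.
  have /andP[h _] := form_le z; have {}h : Z <= \sum_i psi' p (q i) * y i ^+ 2.
    by apply: le_trans h; rewrite ler_peMl ?(ltW Zp) //; lra.
  apply: le_trans h _; rewrite mulr_sumr; apply: ler_sum => i _.
  have [y0|yn0] := eqVneq (y i) 0.
    by rewrite y0 expr0n mulr0 mulr_ge0 ?powR_ge0.
  have y2 : 0 < y i ^+ 2 by rewrite exprn_even_gt0.
  have qp : 0 < q i.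
    by rewrite -(pmulr_lgt0 _ Zp) (lt_le_trans y2) // y_q.
  apply: (@le_trans _ _ (q i `^ (p / 2 - 1) * y i ^+ 2)).
    by rewrite ler_wpM2r ?sqr_ge0 // psi'_le.
  have : q i `^ (p / 2 - 1) <= (y i ^+ 2 / Z) `^ (p / 2 - 1).
    rewrite -[p / 2 - 1]opprB !powRN lef_pV2 ?posrE ?powR_gt0 ?divr_gt0 //.
    apply: ge0_ler_powR; rewrite ?nnegrE ?divr_ge0 ?(ltW qp) ?(ltW y2) ?(ltW Zp) //.
      by lra.
    by rewrite ler_pdivrMr // y_q.
  move=> /(ler_wpM2r (ltW y2)) h; apply: le_trans h _.
  rewrite powRM ?(ltW y2) ?invr_ge0 ?(ltW Zp) //.
  rewrite -[Z^-1]powR_inv1 ?(ltW Zp) // -powRrM.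
  rewrite (_ : -1 * (p / 2 - 1) = 1 - p / 2); last by ring.
  rewrite mulrAC [X in X <= _]mulrC ler_wpM2l ?powR_ge0 //.
  rewrite [_ * y i ^+ 2]mulrC mulr_powRB1 ?(ltW y2) //; last by lra.
  rewrite -real_normK ?num_real // -powR_mulrn // -powRrM.
  by rewrite (_ : 2%:R * (p / 2) = p) //; field.
have Zpp : 0 < Z `^ (1 - p / 2) by rewrite powR_gt0.
rewrite -(ler_pM2l Zpp) -powRD ?(gt_eqF Zp) ?implybT //.
by rewrite subrK powRr1 ?(ltW Zp).
Qed.

(** For [q_i <= 1] this is Cauchy-Schwarz raised to the power [p / 2], combined with
    [dot_le_sum_powR]; otherwise [lam_i >= 1] and a single term is at most the whole sum. *)
Lemma sensitivity_le i : `|y i| `^ p <= lam i * P.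
Proof.
have hp1 := p1; have hp2 := p2; have hL := L14.
have [q1|/ltW q1] := leP (q i) 1.
  rewrite /lam psi_le1 ?q0 //; apply: le_trans (ler_wpM2l (powR_ge0 _ _) dot_le_sum_powR).
  rewrite -powRM ?q0 ?dot_ge0 //.
  have -> : `|y i| `^ p = (y i ^+ 2) `^ (p / 2).
    rewrite -real_normK ?num_real // -powR_mulrn // -powRrM.
    by rewrite (_ : 2%:R * (p / 2) = p) //; field.
  apply: ge0_ler_powR; rewrite ?nnegrE ?sqr_ge0 ?mulr_ge0 ?invr_ge0 ?q0 ?dot_ge0 //; try lra.
have lam1 : 1 <= lam i.
  by rewrite /lam psi_ge1 // powR_ge1 ?invr_ge0.
apply: (@le_trans _ _ P); last by rewrite ler_peMl.
by rewrite /P (bigD1 i) //= lerDl sumr_ge0 // => j _; apply: powR_ge0.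
Qed.

Variable u : 'I_n -> R.
Hypothesis u0 : forall i, 0 < u i.

Let Dy i := (u i `^ p^-1)^-1 * y i.
Let V := \sum_i Dy i ^+ 2.

Let Dy2 i : Dy i ^+ 2 = (`|y i| `^ p / u i) `^ (2 / p).
Proof.
have hu := u0 i; rewrite /Dy exprMn exprVn powRM ?powR_ge0 ?invr_ge0 ?(ltW hu) //.
rewrite -powRrM (_ : p * (2 / p) = 2%:R); last by field; rewrite gt_eqF.
rewrite powR_mulrn // real_normK ?num_real // mulrC; congr (_ * _).
rewrite -[in RHS]powR_inv1 ?(ltW hu) // -powRrM -powR_mulrn ?powR_ge0 // -powRrM.
by rewrite -powRN; congr (_ `^ _); field; rewrite gt_eqF.
Qed.

Lemma scaled_upper : V <= P `^ (2 / p) * \sum_i (lam i / u i) `^ (2 / p).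
Proof.
rewrite mulr_sumr; apply: ler_sum => i _; have hu := u0 i.
rewrite Dy2 -powRM ?divr_ge0 ?(ltW hu) //.
apply: ge0_ler_powR; rewrite ?nnegrE ?mulr_ge0 ?powR_ge0 ?invr_ge0 ?(ltW hu) ?(ltW p0) //.
by rewrite mulrA ler_wpM2r ?invr_ge0 ?(ltW hu) // mulrC sensitivity_le.
Qed.

(** Chosen so that the coefficient times the selection probability [1 - exp (- psi r)] is comparable
    to [psi' r]: that probability is of order [psi r] for [r <= 1] and bounded below for larger
    [r]. *)
Definition row_coef r := if r <= 1 then psi' p r / psi p r else psi' p r.

Lemma row_coef_ge0 r : 0 <= row_coef r.
Proof.
by rewrite /row_coef; case: ifP => _; rewrite ?divr_ge0 ?psi'_ge0 ?psi_ge0.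
Qed.

(** A selected index has [D_ii^2 >= lam_i^(-2/p)]. This equals [1 / q_i] for [q_i <= 1]; for larger
    [q_i] it is at least [lam_i^(-2) = q_i^(-2/3)], three times [psi' q_i]. *)
Let coef_u i : u i <= lam i -> row_coef (q i) * y i ^+ 2 <= Dy i ^+ 2.
Proof.
move=> ul; have hu := u0 i; have hp1 := p1; have hp2 := p2.
have l0 : 0 < lam i by apply: lt_le_trans ul.
have qp : 0 < q i.
  rewrite lt_def q0 andbT; apply: contraTneq l0 => qi0.
  by rewrite -leNgt /lam qi0 psi_le1 ?lexx ?ler01 // powR0 // gt_eqF //; lra.
rewrite /Dy exprMn ler_wpM2r ?sqr_ge0 // exprVn -[leRHS]mul1r.
have D0 : 0 < u i `^ p^-1 by rewrite powR_gt0.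
rewrite ler_pdivlMr ?exprn_gt0 //.
have : (u i `^ p^-1) ^+ 2 <= lam i `^ (2 / p).
  rewrite -powR_mulrn ?powR_ge0 // -powRrM [p^-1 * _]mulrC.
  by apply: ge0_ler_powR; rewrite ?nnegrE ?divr_ge0 ?(ltW hu) ?(ltW l0) ?(ltW p0).
move=> /(ler_wpM2l (row_coef_ge0 (q i))) h; apply: le_trans h _.
rewrite /row_coef; case: (leP (q i) 1) => q1.
  have -> : lam i `^ (2 / p) = q i.
    rewrite /lam psi_le1 ?q0 // -powRrM (_ : p / 2 * _ = 1) ?powRr1 //.
    by field; rewrite gt_eqF.
  by rewrite mulrAC ler_pdivrMr // mul1r psi'M_le.
have lam1 : 1 <= lam i.
  by rewrite /lam psi_ge1 ?(ltW q1) // powR_ge1 ?invr_ge0 // ltW.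
apply: (@le_trans _ _ (psi' p (q i) * lam i `^ 2%:R)).
  rewrite ler_wpM2l ?psi'_ge0 //; apply: ler_powR => //.
  by rewrite ler_pdivrMr //; lra.
rewrite /lam psi_ge1 ?(ltW q1) // -powRrM /psi' (leNgt (q i) 1) q1 /= -mulrA -powRD; last first.
  by rewrite (gt_eqF qp) implybT.
by rewrite (_ : 3^-1 - 1 + 3^-1 * 2 = 0) ?powRr0; [lra|field].
Qed.

Variable Kf : R.
Hypothesis Kf0 : 0 <= Kf.
Hypothesis form_sampled : 5 * L * dot z z <=
  Kf * \sum_i (if u i <= lam i then row_coef (q i) * y i ^+ 2 else 0).

Let form_V : \sum_i psi' p (q i) * y i ^+ 2 <= Kf * V.
Proof.
have /andP[_ h] := form_le z; apply: le_trans h (le_trans form_sampled _).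
rewrite ler_wpM2l //; apply: ler_sum => i _; case: ifP => [|_]; first exact: coef_u.
by rewrite sqr_ge0.
Qed.

Variable Kh : R.
Hypothesis Kh1 : 1 <= Kh.
Hypothesis heavy_sum : \sum_(i | 1 < q i) u i `^ (2 / (2 - p)) <= Kh * (d%:R * L).

Let p2_01 : 0 < p / 2 < 1.
Proof. by have := p1; have := p2 => *; apply/andP; split; lra. Qed.

Let dL0 : 0 <= d%:R * L.
Proof. by rewrite mulr_ge0 //; have := L14; lra. Qed.

Let V0 : 0 <= V. Proof. by apply: sumr_ge0 => i _; apply: sqr_ge0. Qed.

(** Here [|y|^p] is the product of [(y^2 q^(p/2 - 1))^(p/2)] and [lam^(1 - p/2)], the powers of [q]
    cancelling. Hoelder's inequality applies, and [q^(p/2 - 1) <= 2 psi' q] because [p >= 1]. *)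
Let light_le : \sum_(i | q i <= 1) `|y i| `^ p <=
  (2 * Kf * V) `^ (p / 2) * (d%:R * L) `^ (1 - p / 2).
Proof.
have hp1 := p1; have hp2 := p2; have hL := L14.
apply: le_trans (_ : \sum_(i | q i <= 1)
  (y i ^+ 2 * q i `^ (p / 2 - 1)) `^ (p / 2) * lam i `^ (1 - p / 2) <= _).
  apply: ler_sum => i q1; rewrite powRM ?sqr_ge0 ?powR_ge0 //.
  have [y0|yn0] := eqVneq (y i) 0.
    by rewrite y0 normr0 powR0 ?gt_eqF // !mulr_ge0 ?powR_ge0.
  have qp : 0 < q i.
    rewrite lt_def q0 andbT; apply: contra_neq yn0 => qi0.
    by have := y_q i; rewrite qi0 mul0r => h; apply/eqP; rewrite -sqrf_eq0 eq_le h sqr_ge0.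
  rewrite /lam psi_le1 ?q0 // -!powRrM -mulrA -powRD; last by rewrite (gt_eqF qp) implybT.
  rewrite (_ : _ + _ = 0) ?powRr0 ?mulr1; last by field.
  rewrite -real_normK ?num_real // -powR_mulrn // -powRrM.
  by rewrite (_ : 2%:R * (p / 2) = p) //; field.
apply: le_trans (holder_sum _ p2_01 _ lam0) _.
  by move=> i; rewrite mulr_ge0 ?powR_ge0 ?sqr_ge0.
have S0 : 0 <= \sum_(i | q i <= 1) y i ^+ 2 * q i `^ (p / 2 - 1).
  by apply: sumr_ge0 => i _; rewrite mulr_ge0 ?powR_ge0 ?sqr_ge0.
have S1 : 0 <= \sum_(i | q i <= 1) lam i by apply: sumr_ge0.
apply: ler_pM; rewrite ?powR_ge0 //; apply: ge0_ler_powR;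
  rewrite ?nnegrE ?mulr_ge0 //; try lra.
  rewrite -mulrA; apply: le_trans (ler_wpM2l _ form_V); rewrite // mulr_sumr.
  rewrite [leRHS](bigID (fun i => q i <= 1)) /= ler_wpDr //.
    by apply: sumr_ge0 => i _; rewrite mulr_ge0 // mulr_ge0 ?psi'_ge0 // sqr_ge0.
  apply: ler_sum => i q1; rewrite [leLHS]mulrC [leRHS]mulrA ler_wpM2r ?sqr_ge0 //.
  by rewrite /psi' q1 mulrA ler_peMl ?powR_ge0 //; lra.
apply: le_trans lam_sum; rewrite [leRHS](bigID (fun i => q i <= 1)) /= lerDl.
by apply: sumr_ge0.
Qed.

(** Undoing the scaling, [|y|^p] is [(D y)^2] to the power [p / 2], times [u]. Hoelder's inequality
    leaves the moment of [u] of order [2 / (2 - p)], which is harmless over few indices. *)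
Let heavy_le : \sum_(i | 1 < q i) `|y i| `^ p <=
  V `^ (p / 2) * (Kh * (d%:R * L)) `^ (1 - p / 2).
Proof.
have hp1 := p1; have hp2 := p2; have hp0 := p0; have hL := L14.
apply: le_trans (_ : \sum_(i | 1 < q i)
  (Dy i ^+ 2) `^ (p / 2) * (u i `^ (2 / (2 - p))) `^ (1 - p / 2) <= _).
  apply: ler_sum => i q1; have hu := u0 i; rewrite Dy2 -!powRrM.
  rewrite (_ : 2 / p * (p / 2) = 1); last by field; lra.
  rewrite (_ : 2 / (2 - p) * (1 - p / 2) = 1); last by field; lra.
  by rewrite !powRr1 ?divr_ge0 ?powR_ge0 ?(ltW hu) // divfK // gt_eqF.
apply: le_trans (holder_sum _ p2_01 _ _) _ => [i|i|]; rewrite ?sqr_ge0 ?powR_ge0 //.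
have S0 : 0 <= \sum_(i | 1 < q i) Dy i ^+ 2 by apply: sumr_ge0 => i _; apply: sqr_ge0.
have S1 : 0 <= \sum_(i | 1 < q i) u i `^ (2 / (2 - p)).
  by apply: sumr_ge0 => i _; apply: powR_ge0.
have Kh0 : 0 <= Kh := le_trans ler01 Kh1.
apply: ler_pM; rewrite ?powR_ge0 //; apply: ge0_ler_powR;
  rewrite ?nnegrE ?mulr_ge0 //; try lra.
by rewrite /V [leRHS](bigID (fun i => 1 < q i)) /= lerDl sumr_ge0 // => i _; apply: sqr_ge0.
Qed.

Lemma scaled_lower : P <=
  (2 * Kf + 2) * (V `^ (p / 2) * (Kh * (d%:R * L)) `^ (1 - p / 2)).
Proof.
have hp1 := p1; have hp2 := p2; have Kh0 : 0 <= Kh := le_trans ler01 Kh1; have hL := L14.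
rewrite /P (bigID (fun i => q i <= 1)) /=; under [X in _ + X]eq_bigl do rewrite -ltNge.
apply: le_trans (lerD light_le heavy_le) _; rewrite -[2 * Kf + 2]/(2 * Kf + (1 + 1)).
rewrite addrA [leRHS]mulrDl mul1r lerD2r powRM ?mulr_ge0 // -mulrA.
apply: ler_pM; rewrite ?mulr_ge0 ?powR_ge0 //.
  have [K1|/ltW K1] := leP (2 * Kf) 1.
    apply: (@le_trans _ _ 1); last by rewrite lerDr mulr_ge0.
    by rewrite powR_le1 ?K1 ?mulr_ge0 //; lra.
  by apply: le_trans (ler1_powR _ _) _ => //; lra.
apply: ler_wpM2l; first exact: powR_ge0.
apply: ge0_ler_powR; rewrite ?nnegrE ?mulr_ge0 //; try lra.
by rewrite ler_peMl.
Qed.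

End Deterministic.

(** * Exponential random variables *)

Local Open Scope classical_set_scope.
Local Open Scope ring_scope.

(** * Markov and union bounds for finite sums of indicators *)

Section Probability.
Context (R : realType) (disp : measure_display) (T : measurableType disp)
  (P : probability T R).

Lemma measurable_fun_sum_indic (I : finType) (B : I -> set T) (c : I -> R) :
  (forall i, measurable (B i)) ->
  measurable_fun setT (fun x => \sum_i c i * \1_(B i) x).
by move=> mB; apply: measurable_sum => i; apply: measurable_funM.
Qed.

Lemma measurable_set_le (f g : T -> R) : measurable_fun setT f ->
  measurable_fun setT g -> measurable [set x | f x <= g x].
Proof.
move=> mf mg; have := measurable_fun_ler mf mg => /(_ measurableT [set true] I).
by rewrite setTI.
Qed.

(** With sums restricted to weighted indicators, only tail probabilities of the [u i] have to be
    known, and no integral of a power of them is computed. *)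
Lemma markov_sum_indic (I : finType) (B : I -> set T) (c pr : I -> R) (t : R) :
  0 < t -> (forall i, measurable (B i)) -> (forall i, 0 <= c i) ->
  (forall i, P (B i) <= (pr i)%:E)%E ->
  (P [set x | t <= \sum_i c i * \1_(B i) x]%R <= ((\sum_i c i * pr i) / t)%:E)%E.
Proof.
move=> t0 mB c0 Pp; pose f x := \sum_i c i * \1_(B i) x; set E := [set x | _].
have mf : measurable_fun setT f by exact: measurable_fun_sum_indic.
have mE : measurable E by exact: measurable_set_le.
have le1 : (\int[P]_x (t * \1_E x)%:E <= \int[P]_x (f x)%:E)%E.
  apply: ge0_le_integral => //.
  - by move=> x _; rewrite lee_fin mulr_ge0 // ltW.
  - apply/measurable_EFinP; exact: measurable_funM.
  - exact/measurable_EFinP.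
  - move=> x _; rewrite lee_fin indicE; case: (boolP (x \in E)) => xE.
      by rewrite mulr1; move: xE; rewrite inE.
    by rewrite mulr0 sumr_ge0 // => i _; rewrite mulr_ge0.
have intl : (\int[P]_x (t * \1_E x)%:E = t%:E * P E)%E.
  under eq_integral do rewrite EFinM.
  rewrite ge0_integralZl_EFin //; last exact: ltW.
    by rewrite integral_indic // setIT.
  by apply/measurable_EFinP; exact: measurable_indic.
have intr : (\int[P]_x (f x)%:E = \sum_i (c i)%:E * P (B i))%E.
  rewrite /f; under eq_integral do rewrite -sumEFin.
  rewrite ge0_integral_sum //=.
  - apply: eq_bigr => i _; under eq_integral do rewrite EFinM.
    rewrite ge0_integralZl_EFin //.
      by rewrite integral_indic // setIT.
    by apply/measurable_EFinP; exact: measurable_indic.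
  - by move=> i; apply/measurable_EFinP; exact: measurable_funM.
  - by move=> i x _; rewrite lee_fin mulr_ge0.
rewrite EFinM lee_pdivlMr // muleC -intl; apply: le_trans le1 _.
rewrite intr -sumEFin; apply: lee_sum => i _; rewrite EFinM.
by apply: lee_wpmul2l; rewrite ?lee_fin.
Qed.

Lemma probability_finite_union (I : finType) (Q : pred I) (B : I -> set T) (pr : I -> R) :
  (forall i, measurable (B i)) -> (forall i, P (B i) <= (pr i)%:E)%E ->
  (P (\bigcup_(i in [set i | Q i]) B i) <= (\sum_(i | Q i) pr i)%:E)%E.
Proof.
move=> mB Pp; pose c i : R := (Q i)%:R.
have := @markov_sum_indic I B c pr 1 ltr01 mB (fun i => ler0n _ _) Pp.
have -> : [set x | 1 <= \sum_i c i * \1_(B i) x] = \bigcup_(i in [set i | Q i]) B i.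
  apply/seteqP; split => x /=.
    move=> h; apply: contrapT => nx; move: h; rewrite big1 ?ler10 // => i _.
    rewrite /c; case Qi : (Q i); rewrite ?mul0r // mul1r indicE memNset //.
    by move=> Bi; apply: nx; exists i.
  move=> [i /= Qi Bi]; rewrite (bigD1 i) //= {1}/c Qi mul1r indicE mem_set //.
  by rewrite lerDl sumr_ge0 // => j _; rewrite mulr_ge0.
suff -> : \sum_(i | Q i) pr i = \sum_i c i * pr i by rewrite divr1.
rewrite big_mkcond; apply: eq_bigr => i _.
by rewrite /c; case: (Q i); rewrite ?mul1r ?mul0r.
Qed.

End Probability.

Section ExponentialVariables.
Context (R : realType) (disp : measure_display) (T : measurableType disp)
  (P : probability T R) (n : nat) (u : 'I_n -> {RV P >-> R}).
Hypothesis iid : iid_std_exponential u.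

Lemma measurable_le_cst i (a : R) : measurable [set t | u i t <= a].
Proof. by apply: measurable_set_le => //; exact: measurable_cst. Qed.

Lemma measurable_gt_cst i (a : R) : measurable [set t | a < u i t].
Proof.
rewrite (_ : [set t | _] = ~` [set t | u i t <= a]); last first.
  by apply/seteqP; split=> t /=; rewrite ltNge => /negP.
by apply: measurableC; exact: measurable_le_cst.
Qed.

Lemma exp_le_prob i (a : R) : 0 <= a ->
  P [set t | u i t <= a] = (1 - expR (- a))%:E.
Proof.
have neg0 : P (u i @^-1` `]-oo, (0 : R)[%classic) = 0%E.
  rewrite (iid.1 i) //; apply: integral0_eq => y; rewrite /= in_itv /= => y0.
  by rewrite lt0_exponential_pdf.
have mpre (B : set R) : measurable B -> measurable (u i @^-1` B).
  by move=> mB; rewrite -[X in measurable X]setTI; exact: measurable_funP.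
have pos (b : R) : 0 < b -> P [set t | u i t <= b] = (1 - expR (- b))%:E.
  move=> b0; have -> : [set t | u i t <= b] =
      (u i @^-1` `]-oo, (0 : R)[%classic) `|` (u i @^-1` `[0, b]%classic).
    apply/seteqP; split=> y /=; rewrite !in_itv /=.
      by move=> yb; have [y0|y0] := ltP (u i y) 0; [left|right].
    by case=> [y0|/andP[]//]; rewrite ltW // (lt_trans y0).
  rewrite measureU; [|exact: mpre|exact: mpre|].
    rewrite [X in (X + _)%E]neg0 add0e EFinB -[- b]mulN1r.
    exact: etrans (iid.1 i _ (measurable_itv _)) (exponential_prob_itv0c 1 b0).
  apply/seteqP; split=> y //=; rewrite !in_itv /= => -[y0 /andP[y1 _]].
  by rewrite ltNge y1 in y0.
rewrite le_eqVlt => /predU1P[<-|]; last exact: pos.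
rewrite oppr0 expR0 subrr; apply/eqP; rewrite eq_le measure_ge0 andbT.
apply/lee_addgt0Pr => e e0; rewrite add0e.
apply: (@le_trans _ _ (P [set t | u i t <= e])).
  apply: le_measure; rewrite ?inE; [exact: measurable_le_cst..|].
  by move=> y /= y0; rewrite (le_trans y0) // ltW.
rewrite pos // lee_fin; have := expR_ge1Dx (- e); lra.
Qed.

Lemma exp_gt_prob i (a : R) : 0 <= a -> P [set t | a < u i t] = (expR (- a))%:E.
Proof.
move=> a0; rewrite (_ : [set t | _] = ~` [set t | u i t <= a]); last first.
  by apply/seteqP; split=> t /=; rewrite ltNge => /negP.
rewrite probability_setC ?exp_le_prob //; last exact: measurable_le_cst.
by rewrite -EFinB opprB addrC subrK.
Qed.

(** By independence the threshold pattern of [u] has the product Bernoulli law, so the finite-sum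
    Chernoff bound becomes a statement about [P]. *)
Lemma exp_bern_prob (lam : 'I_n -> R) (bad : pred {ffun 'I_n -> bool}) :
  (forall i, 0 <= lam i) ->
  let B := [set t | bad [ffun i => u i t <= lam i]] in
  measurable B /\
  (P B <= (\sum_(e | bad e) bern_weight (fun i => 1 - expR (- lam i)) e)%:E)%E.
Proof.
move=> lam0 B.
pose S i b := if b then [set y : R | y <= lam i] else [set y | lam i < y].
pose Ev (e : {ffun 'I_n -> bool}) := \bigcap_(i in [set: 'I_n]) (u i @^-1` S i (e i)).
have mS i b : measurable (S i b).
  rewrite /S; case: b.
    rewrite (_ : [set y | y <= lam i] = `]-oo, (lam i)]%classic); first exact: measurable_itv.
    by apply/seteqP; split=> y; rewrite /= in_itv.
  rewrite (_ : [set y | lam i < y] = `](lam i), +oo[%classic); first exact: measurable_itv.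
  by apply/seteqP; split=> y; rewrite /= in_itv /= andbT.
have BE : B = \bigcup_(e in [set e | bad e]) Ev e.
  apply/seteqP; split=> t.
    move=> Bt; exists [ffun i => u i t <= lam i] => // i _.
    by rewrite /= /S ffunE; case: (leP (u i t) (lam i)).
  move=> [e /= bade Ee]; rewrite /B /=; suff -> : [ffun i => u i t <= lam i] = e by [].
  apply/ffunP => i; rewrite ffunE; have := Ee i I; rewrite /= /S.
  by case: (e i) => /=; [move=> ->|rewrite ltNge => /negPf].
have PEv e : P (Ev e) = (bern_weight (fun i => 1 - expR (- lam i)) e)%:E.
  rewrite /Ev iid.2 => [|i]; last exact: mS.
  rewrite /bern_weight -prodEFin; apply: eq_bigr => i _; rewrite /S; case: (e i).
    by rewrite -[RHS](exp_le_prob i).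
  by rewrite opprB addrC subrK -[RHS](exp_gt_prob i).
have mEv e : measurable (Ev e).
  apply: fin_bigcap_measurable => // i _.
  by rewrite -[X in measurable X]setTI; exact: measurable_funP.
split.
  rewrite BE; apply: fin_bigcup_measurable => //.
rewrite BE; apply: probability_finite_union => // e.
by rewrite PEv.
Qed.

End ExponentialVariables.

Lemma geometric_sum_le (R : realFieldType) (x : R) (N : nat) : 0 <= x < 1 ->
  \sum_(k < N) x ^+ k <= (1 - x)^-1.
Proof.
move=> /andP[x0 x1]; have d0 : 0 < 1 - x by rewrite subr_gt0.
rewrite -[leRHS]mul1r ler_pdivlMr //.
suff : (\sum_(k < N) x ^+ k) * (1 - x) = 1 - x ^+ N.
  by move=> ->; rewrite gerBl exprn_ge0.
elim: N => [|N IH]; first by rewrite big_ord0 mul0r expr0 subrr.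
by rewrite big_ord_recr /= mulrDl IH exprSr; ring.
Qed.

Lemma scale_between (R : realDomainType) (f : nat -> R) (x : R) (N : nat) :
  f 0%N < x -> x <= f N -> exists2 k : 'I_N, f k < x & x <= f k.+1.
Proof.
move=> x0; elim: N => [|N IH] xN; first by move: (lt_le_trans x0 xN); rewrite ltxx.
have [/IH[k k1 k2]|h] := leP x (f N); last by exists ord_max.
by exists (widen_ord (leqnSn N) k).
Qed.

(** The inequality [ln y <= y] at [y = x / (2 b)]. *)
Lemma powR_le_expR (R : realType) (b x : R) : 0 < b -> 0 < x ->
  x `^ b <= (2 * b) `^ b * expR (x / 2).
Proof.
move=> b0 x0; have b20 : 0 < 2 * b by rewrite mulr_gt0.
have xb : 0 < x / (2 * b) by rewrite divr_gt0.
have : ln (x / (2 * b)) <= x / (2 * b).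
  have := expR_ge1Dx (ln (x / (2 * b))); rewrite lnK ?posrE //; lra.
rewrite lnM ?posrE ?invr_gt0 // lnV ?posrE // => h.
rewrite /powR !gt_eqF // -expRD ler_expR.
have : b * (ln x - ln (2 * b)) <= b * (x / (2 * b)) by rewrite ler_pM2l.
have -> : b * (x / (2 * b)) = x / 2 by field; rewrite gt_eqF.
lra.
Qed.

(** * Exceptional events for sums of powers of the exponentials *)

Section Events.
Context (R : realType) (disp : measure_display) (T : measurableType disp)
  (P : probability T R) (n : nat) (u : 'I_n -> {RV P >-> R}).
Hypothesis iid : iid_std_exponential u.

Lemma exp_le_prob_le i (a : R) : 0 <= a -> (P [set t | (u i t <= a)%R] <= a%:E)%E.
Proof.
move=> a0; rewrite (exp_le_prob iid) // lee_fin; have := expR_ge1Dx (- a); lra.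
Qed.

(** The first summand bounds the dyadic levels through Markov's inequality, the second the remainder
    below the last level. *)
Definition scaled_sum_const (a : R) : R :=
  40 * 20 `^ (a - 1) / (1 - 2 `^ (1 - a)) + 20 `^ a.

(** The terms have infinite mean. Outside [B1] all ratios [lam_i / u_i] are below [Tt]; a ratio of
    at least [Tt / 2^(k+1)], witnessed by [Bk], is charged [(Tt / 2^k)^a], and the expected charges
    form a geometric series of ratio [2^(1-a)]. *)
Lemma scaled_sum_event (lam : 'I_n -> R) (Lam a : R) :
  1 < a -> 0 < Lam -> (forall i, 0 <= lam i) -> \sum_i lam i <= Lam ->
  exists B : set T, [/\ measurable B, (P B <= (10^-1)%:E)%E &
    forall t, ~ B t -> (forall i, 0 < u i t) /\
      \sum_i (lam i / u i t) `^ a <= scaled_sum_const a * Lam `^ a].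
Proof.
move=> a1 Lam0 lam0 lam_sum; pose Tt := 20 * Lam.
have T0 : 0 < Tt by rewrite mulr_gt0.
pose x : R := 2 `^ (1 - a).
have x1 : x < 1.
  rewrite /x /powR pnatr_eq0 /= -[ltRHS]expR0 ltr_expR nmulr_rlt0; last by lra.
  by rewrite ln_gt0 // ltr1n.
have x0 : 0 <= x by exact: powR_ge0.
pose M := 2 * Tt `^ (a - 1) * Lam / (1 - x).
have M0 : 0 < M by rewrite divr_gt0 ?subr_gt0 // !mulr_gt0 ?powR_gt0.
pose c (k : nat) := (Tt / 2 ^+ k) `^ a.
pose v i (k : nat) := 2 ^+ k.+1 * lam i / Tt.
have v0 i k : 0 <= v i k by rewrite divr_ge0 ?(ltW T0) // mulr_ge0 ?exprn_ge0.
pose B1 := \bigcup_(i in [set i : 'I_n | xpredT i]) [set t | u i t <= lam i / Tt].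
pose Bk (ik : 'I_n * 'I_n) := [set t | u ik.1 t <= v ik.1 ik.2].
have mBk ik : measurable (Bk ik) by exact: measurable_le_cst.
pose B2 := [set t | 20 * M <= \sum_(ik : 'I_n * 'I_n) c ik.2 * \1_(Bk ik) t].
have mB1 : measurable B1.
  by apply: fin_bigcup_measurable => // i _; exact: measurable_le_cst.
have mB2 : measurable B2.
  by apply: measurable_set_le => //; exact: measurable_fun_sum_indic.
have PB1 : (P B1 <= (20^-1)%:E)%E.
  apply: le_trans (probability_finite_union (pr := fun i => lam i / Tt) _ _ _) _.
  - by move=> i; exact: measurable_le_cst.
  - by move=> i; apply: exp_le_prob_le; rewrite divr_ge0 ?(ltW T0).
  rewrite lee_fin -mulr_suml ler_pdivrMr //; apply: le_trans lam_sum _.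
  by rewrite /Tt mulrA mulVf ?mul1r // pnatr_eq0.
have ck k : c k * (2 ^+ k.+1 / Tt) = 2 * Tt `^ (a - 1) * x ^+ k.
  have k2 : 0 < 2 ^+ k :> R by rewrite exprn_gt0.
  rewrite /c powRM ?(ltW T0) ?invr_ge0 ?(ltW k2) // exprS.
  have -> : x ^+ k = 2 ^+ k * (2 ^+ k)^-1 `^ a.
    rewrite /x -powR_mulrn ?powR_ge0 // -powRrM [_ * k%:R]mulrC powRrM powR_mulrn //.
    rewrite powRD ?(gt_eqF k2) ?implybT // powRr1 ?(ltW k2) //; congr (_ * _).
    by rewrite powRN -[(2 ^+ k)^-1]powR_inv1 ?(ltW k2) // -powRrM mulN1r powRN.
  have -> : Tt `^ a = Tt * Tt `^ (a - 1) by rewrite mulr_powRB1 ?(ltW T0) //; lra.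
  by field; rewrite gt_eqF.
have PB2 : (P B2 <= (20^-1)%:E)%E.
  apply: le_trans (@markov_sum_indic _ _ _ P _ Bk (fun ik => c ik.2)
    (fun ik => v ik.1 ik.2) (20 * M) _ mBk _ _) _.
  - by rewrite mulr_gt0.
  - by move=> ik; exact: powR_ge0.
  - by move=> ik; apply: exp_le_prob_le.
  have M20 : 0 < 20 * M by rewrite mulr_gt0.
  rewrite lee_fin ler_pdivrMr // mulrA mulVf ?pnatr_eq0 // mul1r.
  rewrite -(pair_bigA _ (fun i (k : 'I_n) => c k * v i k)) /=.
  have inner i : \sum_(k < n) c k * v i k <= lam i * (2 * Tt `^ (a - 1) / (1 - x)).
    have -> : \sum_(k < n) c k * v i k =
        lam i * (2 * Tt `^ (a - 1) * \sum_(k < n) x ^+ k).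
      rewrite !mulr_sumr; apply: eq_bigr => k _.
      by rewrite -ck /v; ring.
    rewrite ler_wpM2l // ler_wpM2l ?mulr_ge0 ?powR_ge0 //.
    by apply: geometric_sum_le; rewrite x0.
  apply: le_trans (ler_sum _ (fun i _ => inner i)) _.
  rewrite -mulr_suml [M](_ : _ = Lam * (2 * Tt `^ (a - 1) / (1 - x))); last first.
    by rewrite /M; ring.
  by rewrite ler_wpM2r // divr_ge0 ?mulr_ge0 ?powR_ge0 // subr_ge0 ltW.
exists (B1 `|` B2); split; first exact: measurableU.
  apply: le_trans (measureU2 P mB1 mB2) _; apply: le_trans (leeD PB1 PB2) _.
  by rewrite -EFinD lee_fin; lra.
move=> t nB.
have ut i : lam i / Tt < u i t.
  by rewrite ltNge; apply/negP => h; apply: nB; left; exists i.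
have u0 i : 0 < u i t by apply: le_lt_trans (ut i); rewrite divr_ge0 ?(ltW T0).
split=> //; have nB2 : \sum_(ik : 'I_n * 'I_n) c ik.2 * \1_(Bk ik) t < 20 * M.
  by rewrite ltNge; apply/negP => h; apply: nB; right.
have point i : (lam i / u i t) `^ a <=
    \sum_(k < n) c k * \1_(Bk (i, k)) t + (Tt / 2 ^+ n) `^ a.
  have S0 (Q : pred 'I_n) : 0 <= \sum_(k < n | Q k) c k * \1_(Bk (i, k)) t.
    by apply: sumr_ge0 => k _; rewrite mulr_ge0 ?powR_ge0.
  have [l0|ln0] := eqVneq (lam i) 0.
    by rewrite l0 mul0r powR0 ?addr_ge0 ?powR_ge0 ?S0 // gt_eqF //; lra.
  have l0 : 0 < lam i by rewrite lt_def ln0 lam0.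
  have mono y : 0 < y -> y <= u i t * Tt / lam i -> (lam i / u i t) `^ a <= (Tt / y) `^ a.
    move=> y0 yx; apply: ge0_ler_powR; rewrite ?nnegrE ?divr_ge0 ?(ltW l0) ?(ltW T0) ?(ltW y0) ?(ltW (u0 i)) //.
      by lra.
    move: yx; rewrite ler_pdivlMr // => yx.
    by rewrite ler_pdivrMr // mulrAC ler_pdivlMr // mulrC (mulrC Tt).
  have [xn|xn] := leP (u i t * Tt / lam i) (2 ^+ n).
    have x1' : 2 ^+ 0 < u i t * Tt / lam i.
      by rewrite expr0 ltr_pdivlMr // mul1r -ltr_pdivrMr.
    have [k k1 k2] := scale_between (f := fun k => 2 ^+ k) x1' xn.
    rewrite (bigD1 k) //= indicE mem_set; last first.
      rewrite /Bk /v /=; move: k2; rewrite ler_pdivrMr // => k2.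
      by rewrite ler_pdivlMr.
    rewrite mulr1 -addrA ler_wpDr ?addr_ge0 ?powR_ge0 ?S0 //.
    by apply: mono; rewrite ?exprn_gt0 // ltW.
  by rewrite ler_wpDl ?S0 // mono ?exprn_gt0 // ltW.
apply: le_trans (ler_sum _ (fun i _ => point i)) _.
rewrite big_split /= sumr_const card_ord.
have -> : \sum_(i < n) \sum_(k < n) c k * \1_(Bk (i, k)) t =
    \sum_(ik : 'I_n * 'I_n) c ik.2 * \1_(Bk ik) t.
  by rewrite pair_bigA /=; apply: eq_bigr => -[i k].
(* [n] levels suffice: below them each of the [n] terms is at most [(Tt / 2^n)^a], and
   [n < 2^n <= (2^n)^a]. *)
have tail : (Tt / 2 ^+ n) `^ a *+ n <= Tt `^ a.
  have n2 : 0 < 2 ^+ n :> R by rewrite exprn_gt0.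
  rewrite powRM ?(ltW T0) ?invr_ge0 ?(ltW n2) // -mulr_natr -mulrA.
  rewrite ler_piMr ?powR_ge0 // -[(2 ^+ n)^-1]powR_inv1 ?(ltW n2) // -powRrM mulN1r powRN.
  rewrite mulrC ler_pdivrMr ?powR_gt0 // mul1r.
  apply: (@le_trans _ _ (2 ^+ n)).
    by rewrite -natrX ler_nat ltnW // ltn_expl.
  by apply: le1r_powR; [rewrite exprn_ege1 // ler1n|lra].
apply: le_trans (lerD (ltW nB2) tail) _.
have LamE : Lam `^ a = Lam `^ (a - 1) * Lam.
  by rewrite mulrC mulr_powRB1 ?(ltW Lam0) //; lra.
rewrite /scaled_sum_const [leRHS]mulrDl /M /Tt !powRM ?(ltW Lam0) // -/x lerD2r.
by rewrite LamE le_eqVlt; apply/orP; left; apply/eqP; ring.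
Qed.

Definition heavy_const (b : R) : R :=
  20 * ((2 * b) `^ b * expR 2^-1 / (1 - expR (- 2^-1))).

(** A value of [u] in []k, k+1]] is charged [(k+1)^b]. The expected charge is summable because
    [(k+1)^b] is at most a constant times [exp ((k+1)/2)], against a tail [exp (- k)]. *)
Lemma heavy_sum_event (Q : pred 'I_n) (Lam b : R) : 0 < b -> 0 < Lam ->
  \sum_(i | Q i) 1 <= Lam ->
  exists B : set T, [/\ measurable B, (P B <= (10^-1)%:E)%E &
    forall t, ~ B t -> (forall i, 0 < u i t) ->
      \sum_(i | Q i) u i t `^ b <= heavy_const b * Lam].
Proof.
move=> b0 Lam0 Qle; pose N := (20 * n)%N.
pose x : R := expR (- 2^-1); have x0 : 0 <= x by exact: expR_ge0.
have x1 : x < 1 by rewrite /x -[ltRHS]expR0 ltr_expR; lra.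
pose Cb := (2 * b) `^ b * expR 2^-1 / (1 - x).
have Cb0 : 0 < Cb.
  by rewrite divr_gt0 ?subr_gt0 // mulr_gt0 ?powR_gt0 ?mulr_gt0 ?expR_gt0.
pose c (ik : 'I_n * 'I_N) : R := (Q ik.1)%:R * ik.2.+1%:R `^ b.
have c0 ik : 0 <= c ik by rewrite mulr_ge0 ?powR_ge0.
pose B1 := \bigcup_(i in [set i : 'I_n | xpredT i]) [set t | N%:R < u i t].
pose Bk (ik : 'I_n * 'I_N) := [set t | (ik.2)%:R < u ik.1 t].
have mBk ik : measurable (Bk ik) by exact: measurable_gt_cst.
pose B2 := [set t | 20 * (Cb * Lam) <= \sum_(ik : 'I_n * 'I_N) c ik * \1_(Bk ik) t].
have mB1 : measurable B1.
  by apply: fin_bigcup_measurable => // i _; exact: measurable_gt_cst.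
have mB2 : measurable B2.
  by apply: measurable_set_le => //; exact: measurable_fun_sum_indic.
have PB1 : (P B1 <= (20^-1)%:E)%E.
  apply: le_trans (probability_finite_union (pr := fun i => expR (- N%:R)) _ _ _) _.
  - by move=> i; exact: measurable_gt_cst.
  - by move=> i; rewrite (exp_gt_prob iid).
  rewrite lee_fin sumr_const card_ord.
  have -> : expR (- N%:R) *+ n = n%:R / expR N%:R :> R.
    by rewrite expRN -[LHS]mulr_natl.
  rewrite ler_pdivrMr ?expR_gt0 //.
  rewrite mulrC -ler_pdivrMr ?invr_gt0 // invrK.
  apply: le_trans (expR_ge1Dx _); rewrite /N natrM.
  lra.
have PB2 : (P B2 <= (20^-1)%:E)%E.
  apply: le_trans (@markov_sum_indic _ _ _ P _ Bk c
    (fun ik => expR (- (ik.2 : nat)%:R)) (20 * (Cb * Lam)) _ mBk c0 _) _.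
  - by rewrite mulr_gt0 // mulr_gt0.
  - by move=> ik; rewrite (exp_gt_prob iid).
  have CL0 : 0 < 20 * (Cb * Lam) by rewrite mulr_gt0 // mulr_gt0.
  rewrite lee_fin ler_pdivrMr // mulKf ?pnatr_eq0 //.
  rewrite -(pair_bigA _ (fun i (k : 'I_N) => (Q i)%:R * k.+1%:R `^ b * expR (- k%:R))) /=.
  have inner i : \sum_(k < N) (Q i)%:R * k.+1%:R `^ b * expR (- k%:R) <= (Q i)%:R * Cb.
    under eq_bigr do rewrite -mulrA; rewrite -mulr_sumr ler_wpM2l //.
    apply: (@le_trans _ _ (\sum_(k < N) (2 * b) `^ b * expR 2^-1 * x ^+ k)).
      apply: ler_sum => k _.
      have := powR_le_expR b0 (_ : 0 < k.+1%:R); rewrite ltr0n => /(_ isT).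
      move=> /(ler_wpM2r (expR_ge0 (- k%:R))) h; apply: le_trans h _.
      rewrite -!mulrA ler_wpM2l ?powR_ge0 // /x -expRM_natl -!expRD ler_expR.
      by rewrite -natr1; lra.
    rewrite -mulr_sumr /Cb ler_wpM2l ?mulr_ge0 ?powR_ge0 ?expR_ge0 //.
    by apply: geometric_sum_le; rewrite x0.
  apply: le_trans (ler_sum _ (fun i _ => inner i)) _.
  rewrite -mulr_suml mulrC ler_wpM2l ?(ltW Cb0) //.
  apply: le_trans Qle; rewrite [leRHS]big_mkcond; apply: ler_sum => i _.
  by case: (Q i).
exists (B1 `|` B2); split; first exact: measurableU.
  apply: le_trans (measureU2 P mB1 mB2) _; apply: le_trans (leeD PB1 PB2) _.
  by rewrite -EFinD lee_fin; lra.
move=> t nB u0.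
have uN i : u i t <= N%:R.
  by rewrite leNgt; apply/negP => h; apply: nB; left; exists i.
have nB2 : \sum_(ik : 'I_n * 'I_N) c ik * \1_(Bk ik) t < 20 * (Cb * Lam).
  by rewrite ltNge; apply/negP => h; apply: nB; right.
rewrite /heavy_const -/x -/Cb -mulrA; apply: le_trans (ltW nB2).
have -> : \sum_(ik : 'I_n * 'I_N) c ik * \1_(Bk ik) t =
    \sum_(i < n) \sum_(k < N) c (i, k) * \1_(Bk (i, k)) t.
  by rewrite pair_bigA /=; apply: eq_bigr => -[i k].
rewrite big_mkcond; apply: ler_sum => i _.
have S0 (q : pred 'I_N) : 0 <= \sum_(k < N | q k) c (i, k) * \1_(Bk (i, k)) t.
  by apply: sumr_ge0 => k _; rewrite mulr_ge0.
case: ifP => Qi //.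
have [k k1 k2] := scale_between (f := fun k => k%:R) (u0 i) (uN i).
rewrite (bigD1 k) //= indicE mem_set // mulr1 {1}/c /= Qi mul1r ler_wpDr ?S0 //.
by apply: ge0_ler_powR; rewrite ?nnegrE ?(ltW b0) ?(ltW (u0 i)).
Qed.

End Events.

(** * Measurability and independence *)

Lemma continuous_norm_powR (R : realType) (p : R) : 0 < p ->
  continuous (fun a : R => `|a| `^ p).
Proof.
move=> p0 a; have [->|a0] := eqVneq a 0.
  apply/cvgrPdist_lt => e e0; rewrite normr0 powR0 ?gt_eqF //.
  have r0 : 0 < e `^ p^-1 by rewrite powR_gt0.
  exists (e `^ p^-1) => //= y; rewrite /ball /= !sub0r !normrN => yr.
  rewrite ger0_norm ?powR_ge0 //.
  rewrite -[ltRHS]powRr1 ?(ltW e0) // -(mulVf (lt0r_neq0 p0)) powRrM.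
  by apply: gt0_ltr_powR => //; rewrite ?nnegrE ?powR_ge0.
have na : 0 < `|a| by rewrite normr_gt0.
apply: (@continuous_comp _ _ _ (fun y : R => `|y|) (fun y : R => y `^ p)).
  exact: norm_continuous.
apply: differentiable_continuous; apply/derivable1_diffP.
by apply: derivable_powR; rewrite in_itv /= na.
Qed.

Lemma continuous_sum_fun (R : realType) (X : topologicalType) (I : Type) (r : seq I)
    (F : I -> X -> R) : (forall i, continuous (F i)) ->
  continuous (fun x => \sum_(i <- r) F i x).
Proof.
move=> cF; elim: r => [|i r IH] x.
  rewrite (_ : (fun x => _) = cst 0); first exact: cst_continuous.
  by apply/funext => z; rewrite big_nil.
rewrite (_ : (fun x => _) = F i \+ (fun x => \sum_(i <- r) F i x)).
  by apply: continuousD; [exact: cF|exact: IH].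
by apply/funext => z; rewrite big_cons.
Qed.

(** The outer absolute value exhibits the norm as a composition of functions continuous on the whole
    line. *)
Lemma lpnormE (R : realType) n (p : R) (v : 'cV[R]_n) :
  lpnorm p v = `| \sum_i `|v i 0| `^ p | `^ p^-1.
Proof. by rewrite ger0_norm // sumr_ge0 // => i _; exact: powR_ge0. Qed.

Lemma continuous_lpnorm_mulmx (R : realType) m n (p : R) (M : 'M[R]_(m, n)) :
  0 < p -> continuous (fun x : 'cV[R]_n => lpnorm p (M *m x)).
Proof.
move=> p0.
have cM i : continuous (fun y : 'cV[R]_n => (M *m y) i 0).
  rewrite (_ : (fun y => _) = fun y : 'cV[R]_n => \sum_j M i j * y j 0); last first.
    by apply/funext => y; rewrite mxE.
  apply: continuous_sum_fun => j x.
  by apply: continuousM; [exact: cst_continuous|exact: coord_continuous].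
rewrite (_ : (fun x => _) = (fun a : R => `|a| `^ p^-1) \o
    (fun x : 'cV[R]_n => \sum_i `|(M *m x) i 0| `^ p)); last first.
  by apply/funext => x; rewrite lpnormE.
move=> x; apply: continuous_comp.
  apply: continuous_sum_fun => i {}x.
  apply: (@continuous_comp _ _ _ (fun y : 'cV[R]_n => (M *m y) i 0) (fun a : R => `|a| `^ p)).
    exact: cM.
  exact: continuous_norm_powR.
by apply: continuous_norm_powR; rewrite invr_gt0.
Qed.

Lemma measurable_lpnorm (R : realType) d (T : measurableType d) n (p : R)
    (v : T -> 'cV[R]_n) : (forall i, measurable_fun setT (fun t => v t i 0)) ->
  measurable_fun setT (fun t => lpnorm p (v t)).
Proof.
move=> mv; have mp (q : R) (f : T -> R) : measurable_fun setT f ->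
    measurable_fun setT (fun t => f t `^ q).
  by move=> mf; apply: (measurableT_comp (measurable_powR q) mf).
apply: (mp); apply: measurable_sum => i; apply: mp.
exact: measurableT_comp (mv i).
Qed.

Lemma rational_point_nbhs (R : realType) n (x : 'cV[R]_n) (A : set 'cV[R]_n) :
  nbhs x A -> exists q : 'cV[rat]_n, A (map_mx ratr q).
Proof.
move=> /nbhs_ballP[e /= e0 eA].
have ex i : exists q : rat, `|x i 0 - ratr q| < e.
  have [q] := @rat_in_itvoo R (x i 0 - e) (x i 0 + e) ltac:(lra).
  by rewrite in_itv /= => /andP[h1 h2]; exists q; rewrite ltr_norml; apply/andP; split; lra.
exists (\col_i xchoose (ex i)); apply: eA; split=> // i j.
by rewrite !mxE ord1; exact: xchooseP (ex i).
Qed.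

(** By continuity a violation at some [x] persists at a nearby rational point, so countably many
    conditions suffice. *)
Lemma measurable_forall_le (R : realType) d (T : measurableType d) n
    (f g : T -> 'cV[R]_n -> R) :
  (forall x, measurable_fun setT (f^~ x)) -> (forall x, measurable_fun setT (g^~ x)) ->
  (forall t, continuous (f t)) -> (forall t, continuous (g t)) ->
  measurable [set t | forall x, f t x <= g t x].
Proof.
move=> mf mg cf cg.
pose q2x (q : 'cV[rat]_n) : 'cV[R]_n := map_mx ratr q.
rewrite (_ : [set t | _] = ~` \bigcup_(q in [set: 'cV[rat]_n])
    ~` [set t | f t (q2x q) <= g t (q2x q)]).
  apply: measurableC; apply: countable_bigcupT_measurable; first exact: countableP.
  by move=> q; apply: measurableC; exact: measurable_set_le.
apply/seteqP; split=> t /= h.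
  by move=> [q _]; apply; exact: h.
move=> x; rewrite leNgt; apply/negP => gf; apply: h.
have gf0 : 0 < f t x - g t x by rewrite subr_gt0.
have cfg : (fun y => f t y - g t y) @ x --> f t x - g t x.
  exact: (@cvgB _ R^o _ _ _ _ _ _ _ (cf t x) (cg t x)).
have [q hq] := rational_point_nbhs (cvgr_gt _ cfg _ gf0).
by exists q => //= ; apply/negP; rewrite -ltNge -subr_gt0.
Qed.

Lemma measurable_seed_fun (R : realType) d (T : measurableType d) s r n
    (w : T -> sparse_seed s r n) (g : sparse_seed s r n -> R) :
  (forall f, measurable (w @^-1` [set f])) ->
  measurable_fun setT (fun t => g (w t)).
Proof.
move=> mw; rewrite (_ : (fun t => _) = fun t =>
    \sum_f g f * \1_(w @^-1` [set f]) t); first exact: measurable_fun_sum_indic.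
apply/funext => t; rewrite (bigD1 (w t)) //= indicE mem_set // mulr1 big1 ?addr0 //.
by move=> f fw; rewrite indicE memNset ?mulr0 // => wf; move: fw; rewrite wf eqxx.
Qed.

Lemma measurable_scaled_coord (R : realType) d (T : measurableType d) (p c : R)
    (u : T -> R) : measurable_fun setT u ->
  measurable_fun setT (fun t => (u t `^ p^-1)^-1 * c).
Proof.
move=> mu; rewrite (_ : (fun t => _) = fun t => u t `^ (- p^-1) * c); last first.
  by apply/funext => t; rewrite powRN.
apply: measurable_funM => //; exact: (measurableT_comp (measurable_powR _) mu).
Qed.

(** * Independence beyond cylinders *)

Section Independence.
Context (R : realType) (disp : measure_display) (T : measurableType disp)
  (P : probability T R) (n : nat) (u : 'I_n -> {RV P >-> R}).

Definition cylinders : set (set T) := [set E | exists2 B : 'I_n -> set R,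
  forall i, measurable (B i) & E = \bigcap_(i in [set: 'I_n]) (u i @^-1` B i)].

Let preim_measurable i (B : set R) : measurable B -> measurable (u i @^-1` B).
Proof. by move=> mB; rewrite -[X in measurable X]setTI; exact: measurable_funP. Qed.

Let cylinder_measurable E : cylinders E -> measurable E.
Proof.
by move=> [B mB ->]; apply: fin_bigcap_measurable => // i _; exact: preim_measurable.
Qed.

(** A pi-lambda argument. The extension is needed because the embedding events are not cylinders in
    [u]. *)
Lemma cylinder_independent (W : set T) : measurable W ->
  (forall B : 'I_n -> set R, (forall i, measurable (B i)) ->
    P (W `&` \bigcap_(i in [set: 'I_n]) (u i @^-1` B i)) =
    (P W * P (\bigcap_(i in [set: 'I_n]) (u i @^-1` B i)))%E) ->
  forall E, <<s cylinders >> E -> measurable E /\ P (W `&` E) = (P W * P E)%E.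
Proof.
move=> mW hW; apply: (@dynkin_induction _ (g_sigma_algebraType cylinders) cylinders) => //.
- move=> _ _ [B mB ->] [B' mB' ->]; exists (fun i => B i `&` B' i).
    by move=> i; exact: measurableI.
  by rewrite -bigcapI; apply: eq_bigcapr => i _; rewrite preimage_setI.
- by split; rewrite ?setIT ?probability_setT ?mule1.
- move=> E cE; split; first exact: cylinder_measurable.
  by case: cE => B mB ->; exact: hW.
- move=> E _ [mE hE]; split; first exact: measurableC.
  have fW : P W \is a fin_num by exact: fin_num_measure.
  have fE : P E \is a fin_num by exact: fin_num_measure.
  have -> : P (W `&` ~` E) = (P W - P (W `&` E))%E.
    by rewrite -setDE measureD // ltey_eq fW.
  by rewrite hE probability_setC // muleBr ?mule1 // fin_num_adde_defr.
- move=> F _ tF hF; have mF k : @measurable _ T (F k) by case: (hF k).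
  split; first exact: bigcupT_measurable.
  rewrite setI_bigcupr !measure_semi_bigcup //.
  + have fW : P W \is a fin_num by exact: fin_num_measure.
    rewrite -[X in (X * _)%E](fineK fW) -nneseriesZl => [|k _]; last exact: measure_ge0.
    by apply: eq_eseriesr => k _; rewrite fineK //; case: (hF k).
  + exact: bigcupT_measurable.
  + by move=> k; exact: measurableI.
  + exact: trivIset_setIl.
  + by apply: bigcupT_measurable => k; exact: measurableI.
Qed.

Lemma coordinate_measurable i :
  measurable_fun [set: g_sigma_algebraType cylinders] (u i : T -> R).
Proof.
move=> _ B mB; rewrite setTI; apply: sub_sigma_algebra.
exists (fun j => if j == i then B else setT); first by move=> j; case: ifP.
apply/seteqP; split=> t /=.
  by move=> Bt j _; case: eqP => [->|].
by move=> /(_ i I); rewrite eqxx.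
Qed.

End Independence.

(** * Subspace embedding of the random subspace [D V] *)

Section Transfer.
Context (R : realType) (disp : measure_display) (T : measurableType disp)
  (P : probability T R) (p : R) (s r n d : nat).
Variables (u : 'I_n -> {RV P >-> R}) (w : T -> sparse_seed s r n) (A : 'M[R]_(n, d)).
Variable V : {vspace 'cV[R]_n}.
Hypotheses (dimV : \dim V = d) (AV : forall x, A *m x \in V).
Hypotheses (iid : iid_std_exponential u) (unif : uniform_seed P w)
  (indep : seed_independent w u)
  (ose : oblivious_subspace_embedding P d (fun t => sparse_embedding R (w t))).

Let N : R := #|{: sparse_seed s r n}|%:R.
Let Dx t (x : 'cV[R]_d) : 'cV[R]_n := exp_scaling p (fun i => u i t) *m (A *m x).

Definition embeds (f : sparse_seed s r n) (y : 'cV[R]_n) :=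
  2^-1 * lpnorm 2 y <= lpnorm 2 (sparse_embedding R f *m y) <= 3 / 2 * lpnorm 2 y.

(** With the seed frozen at [f], this event depends on [u] alone, so independence from the seed
    applies to it. *)
Let O f := [set t | forall x, embeds f (Dx t x)].

Lemma exp_scalingE (v : 'I_n -> R) (y : 'cV[R]_n) i :
  (exp_scaling p v *m y) i 0 = (v i `^ p^-1)^-1 * y i 0.
Proof. by rewrite /exp_scaling mul_diag_mx !mxE. Qed.

Let Dx_continuous k (S : 'M[R]_(k, n)) t :
  continuous (fun x => lpnorm 2 (S *m Dx t x)).
Proof.
rewrite (_ : (fun x => _) =
  fun x => lpnorm 2 ((S *m (exp_scaling p (fun i => u i t) *m A)) *m x)).
  exact: continuous_lpnorm_mulmx.
by apply/funext => x; rewrite /Dx !mulmxA.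
Qed.

Let DxE x t i : Dx t x i 0 = (u i t `^ p^-1)^-1 * (A *m x) i 0.
Proof. exact: exp_scalingE. Qed.

Let O_measurable f : <<s cylinders u >> (O f).
Proof.
pose T' := g_sigma_algebraType (cylinders u).
have mDx k (S : 'M[R]_(k, n)) x :
    measurable_fun [set: T'] (fun t => lpnorm 2 (S *m Dx t x)).
  apply: measurable_lpnorm => i; under eq_fun do rewrite mxE.
  apply: measurable_sum => j; apply: measurable_funM => //.
  under eq_fun do rewrite DxE.
  by apply: (@measurable_scaled_coord _ _ T'); exact: coordinate_measurable.
have mDx1 (c : R) x : measurable_fun [set: T'] (fun t => c * lpnorm 2 (Dx t x)).
  rewrite (_ : (fun t => _) = fun t => c * lpnorm 2 (1%:M *m Dx t x)); last first.
    by apply/funext => t; rewrite mul1mx.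
  exact: measurable_funM.
have cDx (c : R) t : continuous (fun x => c * lpnorm 2 (Dx t x)).
  have h : continuous (fun x => lpnorm 2 (Dx t x)).
    rewrite (_ : (fun y => _) = fun y => lpnorm 2 (1%:M *m Dx t y)); last first.
      by apply/funext => y; rewrite mul1mx.
    exact: Dx_continuous.
  move=> x; apply: (@continuous_comp _ _ _ (fun x => lpnorm 2 (Dx t x)) ( *%R c)).
    exact: h.
  exact: mulrl_continuous.
have -> : O f = [set t : T' | forall x, 2^-1 * lpnorm 2 (Dx t x) <=
      lpnorm 2 (sparse_embedding R f *m Dx t x)] `&`
    [set t : T' | forall x, lpnorm 2 (sparse_embedding R f *m Dx t x) <=
      3 / 2 * lpnorm 2 (Dx t x)].
  apply/seteqP; split=> t; first by move=> h; split=> x; case/andP: (h x).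
  by move=> [h1 h2] x; apply/andP; split; [exact: h1|exact: h2].
apply: (@measurableI _ T').
  by apply: measurable_forall_le => // t; exact: Dx_continuous.
by apply: measurable_forall_le => // t; exact: Dx_continuous.
Qed.


Let mW f : measurable (w @^-1` [set f]). Proof. by case: (unif f). Qed.
Let mO f : measurable (O f).
Proof.
have h := @cylinder_independent _ _ _ P n u _ (mW f) (indep f) _ (O_measurable f).
by case: h.
Qed.

Let PWO f : P (w @^-1` [set f] `&` O f) = ((N^-1)%:E * P (O f))%E.
Proof.
have [_ ->] := @cylinder_independent _ _ _ P n u _ (mW f) (indep f) _ (O_measurable f).
by case: (unif f) => _ ->.
Qed.

Let U0 := [set t | forall i, 0 < u i t].

Let mU0 : measurable U0.
Proof.
rewrite (_ : U0 = \bigcap_(i in [set: 'I_n]) [set t | 0 < u i t]).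
  by apply: fin_bigcap_measurable => // i _; exact: measurable_gt_cst.
by apply/seteqP; split=> t h i; [move=> _; exact: h|exact: h i I].
Qed.

Let PU0 : P U0 = 1%E.
Proof.
have PC : P (~` U0) = 0%E.
  apply/eqP; rewrite eq_le measure_ge0 andbT.
  have Pi i : (P [set t | (u i t <= 0)%R] <= 0%:E)%E.
    by rewrite (exp_le_prob iid) // oppr0 expR0 subrr.
  have := @probability_finite_union _ _ _ P 'I_n xpredT (fun i => [set t | u i t <= 0])
    (fun=> 0) (fun i => measurable_le_cst u i 0) Pi.
  rewrite big1 // => h; apply: le_trans h.
  apply: le_measure; rewrite ?inE.
  - exact: measurableC.
  - by apply: fin_bigcup_measurable => // i _; exact: measurable_le_cst.
  - move=> t /= nt; apply: contrapT => h'; apply: nt => i.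
    by rewrite ltNge; apply/negP => ui; apply: h'; exists i.
have := probability_setC P mU0; rewrite PC => h.
have fU : P U0 \is a fin_num by exact: fin_num_measure.
move: h; rewrite -(fineK fU) -EFinB => -[] h; congr (_%:E); lra.
Qed.

Let seed_prob (Q : pred (sparse_seed s r n)) :
  measurable [set t | Q (w t)] /\ (P [set t | Q (w t)] <= (\sum_(f | Q f) N^-1)%:E)%E.
Proof.
have -> : [set t | Q (w t)] = \bigcup_(f in [set f | Q f]) (w @^-1` [set f]).
  apply/seteqP; split=> t /=; first by move=> Qt; exists (w t).
  by move=> [f /= Qf wf]; rewrite wf.
split; first by apply: fin_bigcup_measurable => [|f _]; [exact: finite_finset|exact: mW].
by apply: probability_finite_union => // f; case: (unif f) => _ ->.
Qed.

(** Freezing [u] at [t] makes [D] a fixed invertible matrix and [D V] a fixed [d]-dimensional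
    subspace, to which the embedding property applies. The seed being uniform, the probability there
    becomes a proportion of seeds. *)
Let good_seeds t : U0 t -> 99 / 100 <= \sum_f N^-1 * \1_(O f) t.
Proof.
move=> ut; pose D : 'M[R]_n := exp_scaling p (fun i => u i t).
pose lD := linfun (mulmx D : 'cV[R]_n -> 'cV[R]_n).
have lDE y : lD y = D *m y by rewrite lfunE.
have kerD : (lker lD <= 0)%VS.
  apply/subvP => y; rewrite memv_ker lDE memv0 => /eqP Dy; apply/eqP/colP => i.
  have := congr1 (fun z : 'cV[R]_n => z i 0) Dy; rewrite exp_scalingE !mxE => /eqP.
  by rewrite mulf_eq0 invr_eq0 gt_eqF ?powR_gt0 //= => /eqP.
have dimDV : \dim (lD @: V) = d.
  rewrite limg_dim_eq //; apply/eqP; rewrite -subv0.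
  exact: subv_trans (capvSr _ _) kerD.
have := ose dimDV; rewrite /=.
have [mQ PQ] := seed_prob (fun f => `[< O f t >]).
move=> h; have {h} := le_trans h (le_trans _ PQ).
rewrite lee_fin => h; apply: le_trans (h _) _.
  have [mQ' _] := seed_prob (fun f => `[< forall v, v \in (lD @: V)%VS ->
    2^-1 * lpnorm 2 v <= lpnorm 2 (sparse_embedding R f *m v) <= 3 / 2 * lpnorm 2 v >]).
  apply: le_measure; rewrite ?inE //.
    rewrite (_ : [set t | _] = [set t' | `[< forall v, v \in (lD @: V)%VS ->
     2^-1 * lpnorm 2 v <= lpnorm 2 (sparse_embedding R (w t') *m v) <= 3 / 2 * lpnorm 2 v >]]) //.
    by apply/seteqP; split=> t' /asboolP.
  move=> t' /= Et'; apply/asboolP => x; apply: Et'.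
  by rewrite /Dx -lDE; apply: memv_img; exact: AV.
rewrite big_mkcond; apply: ler_sum => f _; rewrite indicE.
case: asboolP => Of; first by rewrite mem_set // mulr1.
by rewrite memNset // mulr0.
Qed.

Definition embedding_event := [set t | forall x, embeds (w t) (Dx t x)].

Lemma embedding_event_prob :
  measurable embedding_event /\ ((99 / 100 : R)%:E <= P embedding_event)%E.
Proof.
have : 0 <= N^-1 by rewrite invr_ge0 ler0n.
move: (PWO) (good_seeds); move: (N^-1) => iN PWO' seeds iN0.
pose F f := w @^-1` [set f] `&` O f.
have mF f : measurable (F f) by exact: measurableI.
have EE : embedding_event = \bigcup_(f in [set: sparse_seed s r n]) F f.
  apply/seteqP; split=> t; first by move=> h; exists (w t).
  by move=> [f _ [/= wf Of]] x; rewrite wf.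
have mE : measurable embedding_event.
  by rewrite EE; apply: fin_bigcup_measurable => //; exact: finite_finset.
split=> //.
have tF : trivIset [set: sparse_seed s r n] F.
  by move=> f g _ _ [t [[/= <- _] [/= <- _]]].
have PE : P embedding_event = (\sum_f iN * fine (P (O f)))%:E.
  have h := @measure_fin_bigcup _ _ _ P _ [set: sparse_seed s r n] F finite_finset tF
    (fun f _ => mF f).
  apply: (etrans (congr1 P EE)); apply: (etrans h).
  have bf := @fsbig_seq _ _ +%E _ (index_enum (sparse_seed s r n)) (fun f => P (F f))
    (index_enum_uniq _).
  have eT : [set` index_enum (sparse_seed s r n)] = [set: sparse_seed s r n].
    by apply/seteqP; split=> // f _; rewrite /= mem_index_enum.
  rewrite eT in bf; apply: (etrans (esym bf)).
  rewrite -sumEFin; apply: eq_bigr => f _.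
  have fO : P (O f) \is a fin_num by exact: fin_num_measure (mO f).
  have e1 : (iN * fine (P (O f)))%:E = (iN%:E * P (O f))%E.
    by rewrite EFinM; congr (_ * _)%E; exact: fineK.
  apply: (etrans _ (esym e1)).
  exact: PWO'.
rewrite PE {PE}.
have Pfine f : (P (O f) <= (fine (P (O f)))%:E)%E.
  have fO : P (O f) \is a fin_num by exact: fin_num_measure (mO f).
  by rewrite (fineK fO).
(* Markov's inequality read backwards: the proportion of good seeds reaches [99/100] almost surely,
   hence so does its mean, which is the probability of the event. *)
have := @markov_sum_indic _ _ _ P (sparse_seed s r n) O (fun=> iN)
  (fun f => fine (P (O f))) (99 / 100) _ mO (fun=> iN0) Pfine.
set E := [set x | _] => /(_ ltac:(lra)) h.
have PE1 : (1%:E <= P E)%E.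
  rewrite -PU0; apply: le_measure; rewrite ?inE //.
    by apply: measurable_set_le => //; exact: measurable_fun_sum_indic.
have {PE1 h} := le_trans PE1 h; rewrite !lee_fin.
move: (\sum_f _) => x; rewrite ler_pdivlMr; lra.
Qed.

End Transfer.

(** * The main theorem *)

Section Sampling.
Variables (R : realType) (p : R).
Hypotheses (p1 : 1 <= p) (p2 : p < 2).

(** For [q <= 1] one step suffices, as [1 - exp (- l) >= l / 3] on [[0, 1]]. For larger [q] the
    coefficient is cut into [k] pieces with [psi q <= k <= 2 psi q], each failing with probability
    [exp (-1/2) <= 2/3]. In both cases one factor 3 of the 9 comes from these estimates, the other
    from the definition of [bernoulli_step]. *)
Lemma bernoulli_step_psi d (v : 'cV[R]_d) (q := dot v v) :
  bernoulli_step (1 - expR (- psi p q)) (row_coef p q) (psi' p q / 9) v.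
Proof.
have hp1 := p1; have hp2 := p2.
have q0 : 0 <= q := dot_ge0 v; have r0 := psi'_ge0 p1 p2 q.
have rq : psi' p q * q <= psi p q by exact: psi'M_le.
have l0 : 0 <= psi p q := psi_ge0 p q.
have c0 : 0 <= psi' p q / 9 by rewrite divr_ge0.
rewrite /bernoulli_step /row_coef; have [q1|q1] := leP q 1.
  exists 1%N, (psi' p q / psi p q), (1 - expR (- psi p q)).
  have [lz|lnz] := eqVneq (psi p q) 0.
    have qz : q = 0.
      apply/eqP; apply: contra_eqT lz => qnz; rewrite psi_le1 ?q0 //.
      by rewrite gt_eqF // powR_gt0 // lt_def qnz.
    have -> : psi' p q = 0.
      by rewrite /psi' qz ler01 powR0 ?mulr0 //; lra.
    by rewrite lz oppr0 expR0 subrr !mul0r !mulr0 subr0 expr1; split=> //; rewrite ?lexx ?ler01.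
  have lp : 0 < psi p q by rewrite lt_def lnz.
  have e1 : expR (- psi p q) <= 1 by rewrite -[leRHS]expR0 ler_expR; lra.
  have e0 := expR_ge0 (- psi p q).
  split.
  - by rewrite divr_ge0.
  - by rewrite -/q mulrAC ler_pdivrMr // mul1r.
  - by apply/andP; split; lra.
  - by rewrite mul1r.
  split; first by rewrite expr1.
  rewrite c0 /= -!mulrA ler_wpM2l // ler_pdivlMl //.
  have := expR_ge1Dx (psi p q); have := expRxMexpNx_1 (psi p q).
  have l1 : psi p q <= 1 by rewrite psi_le1 ?q0 // powR_le1 ?q0 //; lra.
  move: (psi p q) (expR (psi p q)) (expR (- psi p q)) l1 lp e0 e1 => l x y.
  move=> l1 lp y0 y1 xy xl.
  have := ler_wpM2r y0 xl; rewrite xy => h.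
  nra.
have lam1 : 1 <= psi p q by rewrite psi_ge1 ?(ltW q1) // powR_ge1 // ltW.
pose k := (Num.truncn (psi p q)).+1; pose g := psi' p q / k%:R.
have k0 : 0 < k%:R :> R by rewrite ltr0n.
have kl : psi p q <= k%:R by rewrite ltW // truncnS_gt.
have k2 : k%:R / 2 <= psi p q.
  have : (Num.truncn (psi p q))%:R <= psi p q by rewrite truncn_le.
  rewrite /k -natr1; lra.
exists k, g, (1 - expR (- 2^-1)).
have e1 : expR (- 2^-1) <= 2 / 3 :> R.
  have := expR_ge1Dx (2^-1 : R); have := expRxMexpNx_1 (2^-1 : R).
  have := expR_ge0 (- 2^-1 : R); nra.
have e0 := expR_ge0 (- 2^-1 : R).
split.
- by rewrite divr_ge0 // ltW.
- by rewrite -/q /g mulrAC ler_pdivrMr // mul1r (le_trans rq).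
- by apply/andP; split; lra.
- by rewrite /g mulrC divfK // gt_eqF.
split.
  by rewrite !subKr -expRM_natl ler_expR mulrN lerN2.
rewrite c0 /= -!mulrA ler_wpM2l //; lra.
Qed.

End Sampling.

Lemma ln_ge_half (R : realType) (n : nat) : (2 <= n)%N -> 2^-1 <= ln n%:R :> R.
Proof.
move=> n2; apply: (@le_trans _ _ (ln 2)).
  rewrite -ler_expR lnK ?posrE //.
  have := expR_ge1Dx (- 2^-1 : R); have := expRxMexpNx_1 (2^-1 : R).
  have := expR_gt0 (2^-1 : R); nra.
by rewrite ler_ln ?posrE ?ler_nat // ltr0n (leq_trans _ n2).
Qed.

(** The summand 8 brings the failure probability [d / 2^m] below [1/100], since [2^8 >= 200]. *)
Definition chernoff_exponent (d : nat) : nat := (trunc_log 2 d + 8)%N.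

(** From [ln 2 >= 1/2] the logarithm costs [2 ln d], and from [ln d >= 1/2] the summand 8 costs
    [16 ln d]. *)
Lemma chernoff_exponent_le (R : realType) (d : nat) : (2 <= d)%N ->
  (chernoff_exponent d)%:R <= 18 * ln d%:R :> R.
Proof.
move=> d2; have h := ln_ge_half R d2; have d0 : (0 < d)%N by rewrite ltnW.
have l2 := ln_ge_half R (leqnn 2).
have : (trunc_log 2 d)%:R * ln 2 <= ln d%:R :> R.
  rewrite mulrC mulr_natr -lnXn // ler_ln ?posrE ?exprn_gt0 ?ltr0n //.
  by rewrite -natrX ler_nat trunc_logP.
rewrite /chernoff_exponent natrD; move: (_%:R) (ler0n R (trunc_log 2 d)) => t t0.
nra.
Qed.

Lemma chernoff_exponent_exp (R : realType) (d : nat) :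
  d%:R / 2 ^+ chernoff_exponent d <= 100^-1 :> R.
Proof.
rewrite ler_pdivrMr ?exprn_gt0 // mulrC ler_pdivlMr //.
rewrite -natrX -natrM ler_nat /chernoff_exponent.
have := trunc_log_ltn d (isT : (1 < 2)%N); rewrite expnS expnD => h.
apply: (@leq_trans (2 * 2 ^ trunc_log 2 d * 100)); first by rewrite leq_mul2r ltnW.
by rewrite -mulnA mulnCA leq_mul2l orbT.
Qed.

(* Named because unification would otherwise unfold the numerals in unary. *)
Definition sampling_rate {R : realType} : R := 756.
Definition log_factor {R : realType} : R := sampling_rate * 18.
Definition form_ratio {R : realType} : R := 1890.

Lemma sampling_rate_gt0 {R : realType} : 0 < sampling_rate :> R.
Proof. by rewrite ltr0n. Qed.

Lemma log_factor_gt0 {R : realType} : 0 < log_factor :> R.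
Proof. by rewrite mulr_gt0 ?sampling_rate_gt0 // ltr0n. Qed.

Lemma form_ratio_gt0 {R : realType} : 0 < form_ratio :> R.
Proof. by rewrite ltr0n. Qed.

Lemma form_ratio2_gt0 {R : realType} : 0 < 2 * form_ratio + 2 :> R.
Proof. exact: addr_gt0 (mulr_gt0 (ltr0Sn _ 1) form_ratio_gt0) (ltr0Sn _ 1). Qed.

Lemma form_ratioE {R : realType} (m x : R) :
  5 * (sampling_rate * m) * x = form_ratio * (2 * m * x).
Proof. by rewrite /form_ratio /sampling_rate; ring. Qed.

(** The origin of 756: the Chernoff bound asks for [3 delta] with [delta = 2 m], the deterministic
    coefficients lose a factor 9, and the form is only known to exceed [L / 14]. *)
Lemma sampling_rateE {R : realType} (m x : R) :
  3 * (2 * m) * x * 9 = sampling_rate * m / 14 * x.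
Proof. by rewrite /sampling_rate; field. Qed.

Lemma sampling_rate_ge {R : realType} (m : R) : 8 <= m -> 14 <= sampling_rate * m.
Proof. rewrite /sampling_rate; lra. Qed.

(** * The constants of the distortion bounds *)

Section Constants.
Context {R : realType} (p : R).
Hypotheses (p1 : 1 <= p) (p2 : p < 2).

Lemma scaled_sum_const_gt0 : 0 < scaled_sum_const (2 / p).
Proof.
have hp1 := p1; have hp2 := p2; have p0 : 0 < p by apply: lt_le_trans p1.
have a1 : 1 < 2 / p by rewrite ltr_pdivlMr //; lra.
rewrite /scaled_sum_const addr_gt0 ?powR_gt0 // divr_gt0 ?mulr_gt0 ?powR_gt0 //.
rewrite subr_gt0 /powR pnatr_eq0 /= -[ltRHS]expR0 ltr_expR nmulr_rlt0; last by lra.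
by rewrite ln_gt0 // ltr1n.
Qed.

Definition upper_const : R :=
  3 / 2 * scaled_sum_const (2 / p) `^ 2^-1 * log_factor `^ p^-1.

Definition heavy_factor : R := Num.max 1 (heavy_const (2 / (2 - p))).

(** One factor 2 of the 4 pays for the lower embedding bound [1/2], the other for [max_rate_le]. *)
Definition lower_const : R :=
  (4 * ((2 * form_ratio + 2) `^ p^-1 * (heavy_factor * log_factor) `^ (p^-1 - 2^-1)))^-1.

Lemma upper_const_gt0 : 0 < upper_const.
Proof.
have h1 : 0 < scaled_sum_const (2 / p) `^ 2^-1 := powR_gt0 _ scaled_sum_const_gt0.
have h2 : 0 < (log_factor : R) `^ p^-1 := powR_gt0 _ log_factor_gt0.
have h3 : 0 < 3 / 2 :> R by rewrite divr_gt0.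
exact: mulr_gt0 (mulr_gt0 h3 h1) h2.
Qed.

Lemma lower_const_gt0 : 0 < lower_const.
Proof.
have h0 : 0 < heavy_factor by apply: (@lt_le_trans _ _ 1); rewrite // le_max lexx.
have h1 : 0 < (2 * form_ratio + 2 : R) `^ p^-1.
  exact: powR_gt0 _ form_ratio2_gt0.
have h2 : 0 < (log_factor : R) := log_factor_gt0.
have h4 : 0 < (4 : R) by [].
rewrite invr_gt0; exact: mulr_gt0 h4 (mulr_gt0 h1 (powR_gt0 _ (mulr_gt0 h0 h2))).
Qed.

End Constants.

Lemma lpnorm2E (R : realType) n (v : 'cV[R]_n) :
  lpnorm 2 v = (\sum_i v i 0 ^+ 2) `^ 2^-1.
Proof.
congr (_ `^ _); apply: eq_bigr => i _.
by rewrite powR_mulrn // real_normK ?num_real.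
Qed.

(** The dependence on [n] is harmless: the constant only serves to make the supremum of the
    determinants finite. *)
Lemma auerbach_coord (R : realType) n d (p : R) (A : 'M[R]_(n, d)) : 0 < p ->
  (forall (x : 'cV[R]_d) i, `|x i 0| <= lpnorm p (A *m x)) ->
  forall (x : 'cV[R]_d) b, 0 <= b -> (forall i, `|(A *m x) i 0| <= b) ->
  forall k, `|x k 0| <= n%:R `^ p^-1 * b.
Proof.
move=> p0 hA x b b0 Ab k; apply: le_trans (hA x k) _.
have -> : n%:R `^ p^-1 * b = (\sum_(i < n) b `^ p) `^ p^-1.
  rewrite sumr_const card_ord -[b `^ p *+ n]mulr_natl powRM ?powR_ge0 //.
  by rewrite -powRrM mulfV ?gt_eqF // powRr1.
apply: ge0_ler_powR; rewrite ?nnegrE ?invr_ge0 ?(ltW p0) //.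
- by apply: sumr_ge0 => i _; exact: powR_ge0.
- by apply: sumr_ge0 => i _; exact: powR_ge0.
by apply: ler_sum => i _; apply: ge0_ler_powR; rewrite ?nnegrE ?(ltW p0).
Qed.

(** Applied with [x = d log d] and [y = log n]: up to a factor 2, the bound free of [log n] is at
    least either of the two rates of the theorem. The first needs [y^e >= 1/2] for exponents in
    [[0, 1]], the second [x >= 1]. *)
Lemma max_rate_le (R : realType) (p x y : R) : 1 <= p -> p < 2 ->
  1 <= x -> 2^-1 <= y ->
  Num.max ((x * y) `^ (p^-1 - 2^-1))^-1 (x `^ p^-1)^-1 <=
  2 * (x `^ (p^-1 - 2^-1))^-1.
Proof.
move=> p1 p2 x1 y2; have p0 : 0 < p by apply: lt_le_trans p1.
have x0 : 0 < x by apply: lt_le_trans x1.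
have y0 : 0 < y by apply: lt_le_trans y2; rewrite invr_gt0.
have e0 : 0 <= p^-1 - 2^-1 by rewrite subr_ge0 lef_pV2 ?posrE // ltW.
have e1 : p^-1 - 2^-1 <= 1.
  have : p^-1 <= 1 by rewrite invf_le1. 
  lra.
rewrite ge_max; apply/andP; split.
  rewrite powRM ?(ltW x0) ?(ltW y0) // invfM mulrC ler_wpM2r ?invr_ge0 ?powR_ge0 //.
  have h : 2^-1 <= y `^ (p^-1 - 2^-1).
    apply: (@le_trans _ _ (2^-1 `^ (p^-1 - 2^-1))).
      by rewrite ger1_powR // invr_gt0 ltr0n invf_le1 // ler1n.
    by apply: ge0_ler_powR; rewrite ?nnegrE ?invr_ge0 ?(ltW y0).
  rewrite -[leLHS]mul1r ler_pdivrMr ?powR_gt0 //; lra.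
apply: (@le_trans _ _ (x `^ (p^-1 - 2^-1))^-1).
  by rewrite lef_pV2 ?posrE ?powR_gt0 // ler_powR // lerBlDr lerDl.
by rewrite ler_peMl ?invr_ge0 ?powR_ge0 // ler1n.
Qed.

Lemma rescale_upper (R : realType) (p cs k D Lam P V : R) : 0 < p ->
  0 < cs -> 0 < k -> 0 <= D -> 0 <= P -> 0 <= V -> 0 <= Lam -> Lam <= k * D ->
  V <= P `^ (2 / p) * (cs * Lam `^ (2 / p)) ->
  3 / 2 * V `^ 2^-1 <= 3 / 2 * cs `^ 2^-1 * k `^ p^-1 * D `^ p^-1 * P `^ p^-1.
Proof.
move=> p0 cs0 k0 D0 P0 V0 Lam0 LamD hV.
have half (x : R) : 0 <= x -> (x `^ (2 / p)) `^ 2^-1 = x `^ p^-1.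
  by move=> x0; rewrite -powRrM; congr (_ `^ _); field; rewrite gt_eqF.
have e0 : 0 <= p^-1 by rewrite invr_ge0 ltW.
have h : V `^ 2^-1 <= P `^ p^-1 * (cs `^ 2^-1 * Lam `^ p^-1).
  apply: le_trans (_ : _ <= (P `^ (2 / p) * (cs * Lam `^ (2 / p))) `^ 2^-1) _.
    by apply: ge0_ler_powR; rewrite ?nnegrE ?invr_ge0 // !mulr_ge0 ?powR_ge0 ?ltW.
  rewrite powRM ?powR_ge0 ?mulr_ge0 ?powR_ge0 ?(ltW cs0) //.
  by rewrite powRM ?powR_ge0 ?(ltW cs0) // !half.
have hL : Lam `^ p^-1 <= k `^ p^-1 * D `^ p^-1.
  rewrite -powRM ?(ltW k0) //; apply: ge0_ler_powR => //; rewrite ?nnegrE //.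
  by rewrite mulr_ge0 ?(ltW k0).
have -> : 3 / 2 * cs `^ 2^-1 * k `^ p^-1 * D `^ p^-1 * P `^ p^-1 =
    3 / 2 * (P `^ p^-1 * (cs `^ 2^-1 * (k `^ p^-1 * D `^ p^-1))) by ring.
rewrite ler_wpM2l //; apply: le_trans h _.
by rewrite ler_wpM2l ?powR_ge0 // ler_wpM2l ?powR_ge0.
Qed.

Lemma rescale_lower (R : realType) (p ck kh k D Lam P V : R) : 1 <= p -> p < 2 ->
  0 < ck -> 0 < kh -> 0 < k -> 0 < D -> 0 <= P -> 0 <= V -> 0 <= Lam ->
  Lam <= k * D -> P <= ck * (V `^ (p / 2) * (kh * Lam) `^ (1 - p / 2)) ->
  (4 * (ck `^ p^-1 * (kh * k) `^ (p^-1 - 2^-1)))^-1 *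
    (2 * (D `^ (p^-1 - 2^-1))^-1) * P `^ p^-1 <= 2^-1 * V `^ 2^-1.
Proof.
move=> p1 p2 ck0 kh0 k0 D0 P0 V0 Lam0 LamD hP.
have p0 : 0 < p by apply: lt_le_trans p1.
have e0 : 0 <= p^-1 - 2^-1 by rewrite subr_ge0 lef_pV2 ?posrE // ltW.
have ip0 : 0 <= p^-1 by rewrite invr_ge0 ltW.
have khL : 0 <= kh * Lam by rewrite mulr_ge0 ?(ltW kh0).
set a := ck `^ p^-1; set b := (kh * k) `^ _; set c := D `^ _.
have a0 : 0 < a by rewrite powR_gt0.
have b0 : 0 < b by rewrite powR_gt0 ?mulr_gt0.
have c0 : 0 < c by rewrite powR_gt0.
have h : P `^ p^-1 <= a * (V `^ 2^-1 * (b * c)).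
  apply: le_trans (_ : _ <= (ck * (V `^ (p / 2) * (kh * Lam) `^ (1 - p / 2))) `^ p^-1) _.
    by apply: ge0_ler_powR; rewrite ?nnegrE // mulr_ge0 ?(ltW ck0) // mulr_ge0 ?powR_ge0.
  have vk : 0 <= V `^ (p / 2) * (kh * Lam) `^ (1 - p / 2) by rewrite mulr_ge0 ?powR_ge0.
  rewrite powRM ?(ltW ck0) // ler_wpM2l ?(ltW a0) // powRM ?powR_ge0 // -!powRrM.
  rewrite (_ : p / 2 * p^-1 = 2^-1); last by field; rewrite gt_eqF.
  rewrite ler_wpM2l ?powR_ge0 // (_ : (1 - p / 2) * p^-1 = p^-1 - 2^-1); last first.
    by field; rewrite gt_eqF.
  have kk : 0 <= kh * k by rewrite mulr_ge0 ?(ltW kh0) ?(ltW k0).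
  rewrite /b /c -powRM ?(ltW D0) //.
  apply: ge0_ler_powR => //; rewrite ?nnegrE ?mulr_ge0 ?(ltW kh0) ?(ltW k0) ?(ltW D0) //.
  by rewrite -mulrA ler_wpM2l ?(ltW kh0).
have ab0 : 0 < 4 * (a * b) by rewrite mulr_gt0 // mulr_gt0.
have -> : (4 * (a * b))^-1 * (2 * c^-1) * P `^ p^-1 = (2 * (a * b * c))^-1 * P `^ p^-1.
  by field; rewrite !gt_eqF.
rewrite ler_pdivrMl ?mulr_gt0 //; apply: le_trans h _.
by rewrite le_eqVlt; apply/orP; left; apply/eqP; field.
Qed.

Unset Implicit Arguments.

Theorem theorem4p1 (R : realType) (p : R) (hp1 : 1 <= p) (hp2 : p < 2) :
  exists c C : R, 0 < c /\ 0 < C /\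
  forall (gamma Km Ks : R), 0 < gamma ->
  forall (n d s r : nat),
    (2 <= d)%N -> (0 < s)%N ->
    s%:R <= Ks ->
    (s * r)%:R <= Km * d%:R `^ (1 + gamma) ->
  forall (V : {vspace 'cV[R]_n}) (A : 'M[R]_(n, d)),
    \dim V = d -> auerbach_basis p V A ->
  forall (disp : measure_display) (T : measurableType disp)
         (P : probability T R) (u : 'I_n -> {RV P >-> R})
         (w : T -> sparse_seed s r n),
    iid_std_exponential u ->
    uniform_seed P w ->
    seed_independent w u ->
    oblivious_subspace_embedding P d (fun t => sparse_embedding R (w t)) ->
  let Pi := fun t : T =>
    sparse_embedding R (w t) *m exp_scaling p (fun i => u i t) in
  let good := [set t | forall x : 'cV[R]_d,
        c * Num.max
              ((d%:R * ln d%:R * ln n%:R) `^ (p^-1 - 2^-1))^-1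
              ((d%:R * ln d%:R) `^ p^-1)^-1
          * lpnorm p (A *m x)
          <= lpnorm 2 (Pi t *m A *m x)
        /\
        lpnorm 2 (Pi t *m A *m x)
          <= C * (d%:R * ln d%:R) `^ p^-1 * lpnorm p (A *m x)] in
  ((2 / 3 : R)%:E <= P good)%E.
Proof.
exists (lower_const p), (upper_const p).
split; first exact: lower_const_gt0; split; first exact: upper_const_gt0.
move=> _ _ _ _ n d s r d2 _ _ _ V A dimV [basisA _ coordA] disp T P u w iid unif indep ose.
cbv zeta; set good := [set t | _]; have p0 : 0 < p by apply: lt_le_trans hp1.
have d0 : (0 < d)%N by rewrite ltnW.
have dn : (d <= n)%N.
  by have := dimvS (subvf V); rewrite dimV dimvf dim_matrix; rewrite ?mul1r ?mulr1 ?muln1.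
have AV x : A *m x \in V.
  rewrite (_ : A *m x = \sum_j x j 0 *: col j A); last first.
    apply/colP => i; rewrite mxE summxE; apply: eq_bigr => j _.
    by rewrite !mxE mulrC.
  apply: rpred_sum => j _; apply: rpredZ; apply: basis_mem basisA _.
  by apply/mapP; exists j => //; rewrite mem_enum.
(* [delta = 2 m] is the least shift that the Chernoff bound admits, and [L] is the matching
   oversampling rate, of order [log d]. *)
pose m := chernoff_exponent d; pose delta : R := 2 * m%:R; pose L : R := sampling_rate * m%:R.
have m8 : 8 <= m%:R :> R by rewrite ler_nat leq_addl.
have mle : m%:R <= 18 * ln d%:R :> R by exact: chernoff_exponent_le.
have L14 : 14 <= L by exact: sampling_rate_ge.
have L0 : 0 < L by lra.
have [U [uU lam_sum form_le]] := lewis_weights hp1 hp2 L0 d0 (auerbach_coord p0 coordA).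
pose F := A *m U; pose q i := row_sqr F i; pose lam i := psi p (q i).
have lam0 i : 0 <= lam i by exact: psi_ge0.
have q0 i : 0 <= q i by exact: dot_ge0.
have yE x i : dot (rowv F i) (invmx U *m x) = (A *m x) i 0.
  rewrite /dot /rowv trmxK -row_mul mxE /F -mulmxA (mulmxA U) mulmxV // mul1mx.
  by [].
have dR : 2 <= d%:R :> R by rewrite ler_nat.
pose Lam := d%:R * L; have Lam0 : 0 < Lam by rewrite mulr_gt0 //; lra.
have p2p : 1 < 2 / p by rewrite ltr_pdivlMr // mul1r.
have b0 : 0 < 2 / (2 - p) by rewrite divr_gt0 // subr_gt0.
have [B1 [mB1 PB1 hB1]] := scaled_sum_event iid p2p Lam0 lam0 lam_sum.
have heavy_card : \sum_(i < n | 1 < q i) 1 <= Lam :> R.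
  apply: le_trans lam_sum; rewrite big_mkcond; apply: ler_sum => i _.
  case: ifP => q1; last exact: lam0.
  by rewrite -/F -[row_sqr _ _]/(q i) psi_ge1 ?(ltW q1) // powR_ge1 ?invr_ge0 // ltW.
have [B2 [mB2 PB2 hB2]] := heavy_sum_event iid b0 Lam0 heavy_card.
pose pr i := 1 - expR (- lam i).
pose bg := bern_good m delta (rowv F) (fun i => row_coef p (q i)).
have [mB3 PB3] := exp_bern_prob iid (fun e => ~~ bg e) lam0.
set B3 := [set t | _] in mB3 PB3.
have pr01 i : 0 <= 1 - expR (- lam i) <= 1.
  rewrite subr_ge0 gerBl expR_ge0 andbT -[leRHS]expR0 ler_expR oppr_le0; exact: lam0.
have delta2 : 2 <= delta by rewrite /delta; lra.
have step i : bernoulli_step (1 - expR (- lam i)) (row_coef p (q i)) (psi' p (q i) / 9)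
    (rowv F i) by exact: bernoulli_step_psi.
have coef0 i : 0 <= row_coef p (q i) by exact: row_coef_ge0.
have c_lower (x : 'cV[R]_d) : 3 * delta * dot x x <=
    \sum_i psi' p (q i) / 9 * dot (rowv F i) x ^+ 2.
  have /andP[h _] := form_le x.
  under eq_bigr do rewrite mulrAC; rewrite -mulr_suml ler_pdivlMr //.
  by apply: le_trans h; rewrite /delta sampling_rateE.
have {}PB3 : (P B3 <= (100^-1)%:E)%E.
  apply: le_trans PB3 _; rewrite lee_fin.
  apply: le_trans (bern_bad_le delta2 (lexx _) pr01 coef0 step c_lower) _.
  exact: chernoff_exponent_exp.
have [mE PE] := embedding_event_prob p dimV AV iid unif indep ose.
set E := embedding_event _ _ _ _ in mE PE.
have mDx x : measurable_fun setT (fun t => lpnorm 2 (sparse_embedding R (w t) *m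
    exp_scaling p (fun i => u i t) *m A *m x)).
  apply: measurable_lpnorm => i.
  rewrite (_ : (fun t => _) = fun t => \sum_k sparse_embedding R (w t) i k *
      ((u k t `^ p^-1)^-1 * (A *m x) k 0)); last first.
    apply/funext => t; rewrite -!mulmxA mxE; apply: eq_bigr => k _.
    by rewrite exp_scalingE.
  apply: measurable_sum => k; apply: measurable_funM.
    by apply: (measurable_seed_fun (fun f => sparse_embedding R f i k)) => f; case: (unif f).
  exact: measurable_scaled_coord.
have cA (k : R) : continuous (fun x => k * lpnorm p (A *m x)).
  move=> x; apply: (@continuous_comp _ _ _ (fun x => lpnorm p (A *m x)) ( *%R k)).
    exact: continuous_lpnorm_mulmx.
  exact: mulrl_continuous.
have cDx t : continuous (fun x => lpnorm 2 (sparse_embedding R (w t) *m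
    exp_scaling p (fun i => u i t) *m A *m x)) by exact: continuous_lpnorm_mulmx.
have mgood : measurable good.
  pose Nt t x := lpnorm 2 (sparse_embedding R (w t) *m
    exp_scaling p (fun i => u i t) *m A *m x).
  pose lo (t : T) x := lower_const p * Num.max
    ((d%:R * ln d%:R * ln n%:R) `^ (p^-1 - 2^-1))^-1 ((d%:R * ln d%:R) `^ p^-1)^-1 *
    lpnorm p (A *m x).
  pose up (t : T) x := upper_const p * (d%:R * ln d%:R) `^ p^-1 * lpnorm p (A *m x).
  rewrite (_ : good = [set t | forall x, lo t x <= Nt t x] `&`
      [set t | forall x, Nt t x <= up t x]).
    apply: measurableI.
      by apply: measurable_forall_le => *; [exact: measurable_cst|exact: mDx|exact: cA|exact: cDx].
    by apply: measurable_forall_le => *; [exact: mDx|exact: measurable_cst|exact: cDx|exact: cA].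
  apply/seteqP; split=> t; first by move=> h; split=> x; case: (h x).
  by move=> [h1 h2] x; split; [exact: h1|exact: h2].
have lnd := ln_ge_half R d2; have lnn := ln_ge_half R (leq_trans d2 dn).
pose D : R := d%:R * ln d%:R.
have D1 : 1 <= D by rewrite /D; nra.
have LamD : Lam <= log_factor * D.
  have -> : log_factor * D = d%:R * (sampling_rate * (18 * ln d%:R)).
    by rewrite /D /log_factor; ring.
  apply: ler_wpM2l (ler0n _ _) _ _ _; exact: ler_wpM2l (ltW sampling_rate_gt0) _ _ mle.
have sub : E `<=` good `|` (B1 `|` B2 `|` B3).
  move=> t Et; have [Bt|nB] := pselect ((B1 `|` B2 `|` B3) t); [by right|left].
  have [u0 hS] := hB1 t (fun h => nB (or_introl (or_introl h))).
  have {}hB2 := hB2 t (fun h => nB (or_introl (or_intror h))) u0.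
  have hg : bg [ffun i => u i t <= lam i].
    by apply: contrapT => h; apply: nB; right; apply/negP.
  (* In the coordinates [z] the vector [A x] is [F z], with entries [<f_i, z>]. *)
  move=> x; cbv beta; set z := invmx U *m x.
  pose PP := \sum_i `|dot (rowv F i) z| `^ p.
  pose VV := \sum_i ((u i t `^ p^-1)^-1 * dot (rowv F i) z) ^+ 2.
  have normP : lpnorm p (A *m x) = PP `^ p^-1.
    by congr (_ `^ _); apply: eq_bigr => i _; rewrite yE.
  have normV : lpnorm 2 (exp_scaling p (fun i => u i t) *m (A *m x)) = VV `^ 2^-1.
    rewrite lpnorm2E; congr (_ `^ _); apply: eq_bigr => i _.
    by rewrite exp_scalingE yE.
  have PP0 : 0 <= PP by apply: sumr_ge0 => i _; exact: powR_ge0.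
  have VV0 : 0 <= VV by apply: sumr_ge0 => i _; exact: sqr_ge0.
  have := Et x; rewrite /embeds normV -!mulmxA normP => /andP[lo up].
  split; last first.
    apply: le_trans up _; rewrite /upper_const.
    have hV : VV <= PP `^ (2 / p) * (scaled_sum_const (2 / p) * Lam `^ (2 / p)).
      apply: le_trans (scaled_upper hp1 hp2 L14 form_le z u0) _.
      exact: ler_wpM2l (powR_ge0 _ _) _ _ hS.
    exact: (@rescale_upper R p (scaled_sum_const (2 / p)) log_factor D Lam PP VV p0
      (scaled_sum_const_gt0 hp1 hp2) log_factor_gt0 (le_trans ler01 D1) PP0 VV0
      (ltW Lam0) LamD hV).
  apply: le_trans lo.
  have kh1 : 1 <= heavy_factor p by rewrite le_max lexx.
  have k0 : 0 < log_factor :> R := log_factor_gt0.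
  have ck0 : 0 < 2 * form_ratio + 2 :> R := form_ratio2_gt0.
  have kh0 : 0 < heavy_factor p by apply: lt_le_trans kh1.
  have D0 : 0 < D := lt_le_trans ltr01 D1.
  have sampled : 5 * L * dot z z <= form_ratio * \sum_i
      (if u i t <= lam i then row_coef p (q i) * dot (rowv F i) z ^+ 2 else 0).
    have := bern_good_lower delta2 coef0 z (ltn_addl _ (isT : (0 < 8)%N)) hg.
    under [X in _ <= X -> _]eq_bigr do rewrite ffunE.
    by move=> h; rewrite form_ratioE; apply: ler_wpM2l (ltW form_ratio_gt0) _ _ h.
  have heavy : \sum_(i | 1 < q i) u i t `^ (2 / (2 - p)) <= heavy_factor p * (d%:R * L).
    have hk : heavy_const (2 / (2 - p)) <= heavy_factor p.
      by rewrite /heavy_factor le_max lexx orbT.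
    exact: le_trans hB2 (ler_wpM2r (ltW Lam0) hk).
  have hP : PP <= (2 * form_ratio + 2) * (VV `^ (p / 2) * (heavy_factor p * Lam) `^ (1 - p / 2)).
    exact: (scaled_lower hp1 hp2 L14 lam_sum form_le u0 (ltW form_ratio_gt0) sampled kh1 heavy).
  have hmax := max_rate_le hp1 hp2 D1 lnn.
  have h1 := ler_wpM2r (powR_ge0 PP p^-1) (ler_wpM2l (ltW (lower_const_gt0 p)) hmax).
  exact: le_trans h1 (rescale_lower hp1 hp2 ck0 kh0 k0 D0 PP0 VV0 (ltW Lam0) LamD hP).
have mB : measurable (B1 `|` B2 `|` B3) by apply: measurableU => //; exact: measurableU.
(* The failure probabilities add up to [0.21], and [0.99 - 0.21] exceeds [2/3]. *)
have : (P E <= P good + (10^-1 + 10^-1 + 100^-1)%:E)%E.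
  apply: (le_trans (le_measure P _ _ sub)); rewrite ?inE //; first exact: measurableU.
  apply: le_trans (measureU2 P mgood mB) _; apply: leeD => //.
  apply: le_trans (measureU2 P (measurableU _ _ mB1 mB2) mB3) _.
  rewrite EFinD; apply: leeD => //; apply: le_trans (measureU2 P mB1 mB2) _.
  by rewrite EFinD; apply: leeD.
move=> h; have {h} := le_trans PE h.
have fg : P good \is a fin_num by exact: fin_num_measure.
rewrite -(fineK fg) -EFinD !lee_fin; lra.
Qed.
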